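(* Let $\tau \ge 0$ and $\sigma > 0$. Let $Q\in B_\tau$ be a function that is real-valued on $\mathbb{R}$ and let $Z_Q = \{t_n\}$ denote the set of real and distinct zeros of $Q$. Assume that if $\operatorname{card} Z_Q > 1$ then $\inf_{k\ne \ell} |t_k-t_\ell| > 0$. For $s\ge 0$ let $$A_s(Q) = \inf_{t\in\mathbb{R}} \left( [Q'(t)]^2 + s^2 [Q(t)]^2\right).$$ Then the following two statements hold true. (a) If $f\in B_\sigma$, then $$|f(x)| \le (\sigma + \tau) \left(A_{\sigma + \tau}(Q)\right)^{-1/2} \| Q f \|_{C(\mathbb{R})}, \qquad x \in \mathbb{R}. \qquad ( * )$$ (b) If equality holds in $( * )$ for a point $x = x_0 \in \mathbb{R}$ and for a function $f \in B_\sigma$ that is real-valued on $\mathbb{R}$ with $f \not\equiv 0$, then either $|(Qf)(x_0)| = \| Qf \|_{C(\mathbb{R})}$ or there exist two real constants $S$ and $C$ such that $|S| + |C| > 0$ and $$Q(x) f(x) = S \sin ((\sigma + \tau) x) + C \cos ((\sigma + \tau) x) \qquad \text{for all } x \in \mathbb{R}.$$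
   Context: For $\gamma\ge 0$, $B_\gamma$ denotes the collection of entire functions of exponential type at most $\gamma$: an entire function $f:\mathbb{C}\to\mathbb{C}$ belongs to $B_\gamma$ if and only if for every $\varepsilon>0$ we have $\limsup_{|z|\to\infty}|f(z)|\exp(-(\gamma+\varepsilon)|z|)<\infty$. For a continuous function $g$ on $\mathbb{R}$, $\|g\|_{C(\mathbb{R})} = \sup_{t\in\mathbb{R}}|g(t)|$, which may be $+\infty$. If $\|Qf\|_{C(\mathbb{R})}=+\infty$ or if $A_{\sigma+\tau}(Q)=0$ (where $0^{-1/2}=+\infty$) and $f\not\equiv 0$, the right-hand side of $( * )$ is understood as $+\infty$; for $f\equiv 0$ the inequality $( * )$ is regarded as trivially true. *)

(* Defs.v *)
From Stdlib Require Import Reals.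
From Coquelicot Require Import Coquelicot.
Open Scope R_scope.

Definition entire (f : C -> C) : Prop :=
  forall z : C, ex_derive (K := C_AbsRing) (V := C_NormedModule) f z.

(* limsup of g(z) as |z| -> oo, with values in the extended reals:
   inf over r of sup over |z| > r. *)
Definition limsup_at_infinity (g : C -> R) : Rbar :=
  Rbar_glb (fun v : Rbar => exists r : R,
    v = Lub_Rbar (fun y : R => exists z : C, r < Cmod z /\ y = g z)).

Definition exp_type_le (gamma : R) (f : C -> C) : Prop :=
  entire f /\
  forall eps : R, 0 < eps ->
    Rbar_lt (limsup_at_infinity
               (fun z => Cmod (f z) * exp (- (gamma + eps) * Cmod z)))
            p_infty.

Definition real_on_R (f : C -> C) : Prop :=
  forall t : R, Im (f (RtoC t)) = 0.

Definition not_identically_zero (f : C -> C) : Prop := exists z : C, f z <> RtoC 0.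

Definition sup_norm_R (g : C -> C) : Rbar :=
  Lub_Rbar (fun y : R => exists t : R, y = Cmod (g (RtoC t))).

Definition real_zero (Q : C -> C) (t : R) : Prop := Q (RtoC t) = RtoC 0.

Definition separated_real_zeros (Q : C -> C) : Prop :=
  (exists t u : R, real_zero Q t /\ real_zero Q u /\ t <> u) ->
  Rbar_lt (Finite 0)
    (Glb_Rbar (fun d : R => exists t u : R,
       real_zero Q t /\ real_zero Q u /\ t <> u /\ d = Rabs (t - u))).

(* Used only for Q real-valued on R, where Q(t) and Q'(t) coincide with their
   real parts.  The infimum is over a nonempty set of nonnegative reals, so
   the coercion from Rbar to R loses nothing. *)
Definition A_inf (s : R) (Q : C -> C) : R :=
  real (Glb_Rbar (fun y : R => exists t : R,
    y = (Re (C_derive Q (RtoC t))) ^ 2 + s ^ 2 * (Re (Q (RtoC t))) ^ 2)).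

(* s * A_s(Q)^(-1/2) * ||Q f||, with value +oo if A_s(Q) = 0.  For s > 0 and
   A_s(Q) > 0 the product Rbar_mult is +oo whenever ||Q f|| = +oo.  For f = 0
   the value is nonnegative, so |f(x)| <= bound_rhs is then trivially true. *)
Definition bound_rhs (s : R) (Q f : C -> C) : Rbar :=
  if Req_EM_T (A_inf s Q) 0 then p_infty
  else Rbar_mult (Finite (s * / sqrt (A_inf s Q)))
                 (sup_norm_R (fun z => Cmult (Q z) (f z))).

(* Main.v *)
Require Import Defs.
From Stdlib Require Import Reals.
From Coquelicot Require Import Coquelicot.
From Stdlib Require Import Lra Lia Psatz Classical ClassicalEpsilon.
Open Scope R_scope.

(** The function F = Q f has exponential type s = sigma + tau.  If it is bounded by M on the real
    line and u = Re (c F) for a constant c with |c| = 1, then the inequality of Bernstein and Szego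
    says u'^2 + s^2 u^2 <= s^2 M^2 everywhere on the line.  At a point where a real f has f' = 0 we
    have F' = Q' f, so that f^2 (Q'^2 + s^2 Q^2) <= s^2 M^2 and hence f^2 A <= s^2 M^2 with A the
    infimum A_s(Q).  This is the bound at every critical point of f.  If it failed at x1, with
    H = f(x1) > 0 say, then f could have no interior maximum of height at least H, so f would stay
    above H on a whole half-line starting at x1.  There g = 1/f takes values in (0, 1/H], so by the
    mean value theorem g' is arbitrarily small at suitable points; as Q = F g, at these points
    Q'^2 + s^2 Q^2 is at most s^2 M^2 / H^2 + o(1), which contradicts the failure ([comparison]).
    For equality at x0 the point x0 maximises |f|, so f'(x0) = 0, and Q f attains equality in the
    inequality of Bernstein and Szego at x0; either |F(x0)| = M or F is a sinusoid.

    The inequality of Bernstein and Szego is a statement about conformal geometry.  Let F be real on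
    the line and |F| <= 1 there.  By Phragmen and Lindelof a function of type s bounded by M on the
    line satisfies |F(x + iy)| <= M e^(s|y|) ([growth_off_real_axis]).  Applied to all Chebyshev
    polynomials T_n(F), which are bounded by 1 on the line and have type n s, this puts F(x + iy) into
    the closed ellipse with foci -1, 1 and semi-axes cosh (s y), |sinh (s y)|, whose boundary is the
    image of the line Im = s y under the cosine ([ellipse_bound]).  Letting y tend to 0 gives the inequality.

    For the case of equality, compare F with the cosine c(z) = cos (s (z - x) + theta) that has the
    same value and derivative at x.  Since c(z) lies on the boundary of the ellipse that contains F(z),
    the supporting half-plane at c(z) says that p = (F - c) / sin (s (z - x) + theta) satisfies
    y Im p(x + iy) >= 0 near x.  As p vanishes to second order at x, the harmonic function Im p
    is too flat at x unless it vanishes ([flat_nevanlinna_vanishes]), and then F = c.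

    All of this rests on Cauchy's theorem for rectangles, proved by bisection from mere
    differentiability.  Applied to g(q + e^w), it gives the mean value property on circles around q
    for functions that are only continuous at q; the maximum principle follows from that. *)

(** * Complex differentiability *)

Notation cdiff := (@ex_derive C_AbsRing C_NormedModule).
Notation is_cderive := (@is_derive C_AbsRing C_NormedModule).

Lemma is_cderive_eps (f : C -> C) (z l : C) :
  is_cderive f z l <->
  forall eps, 0 < eps -> exists delta, 0 < delta /\ forall w, Cmod (w - z) < delta ->
    Cmod (f w - f z - (w - z) * l)%C <= eps * Cmod (w - z).
Proof.
split.
- intros [_ H] eps Heps.
  assert (Hl : @is_filter_lim (AbsRing_UniformSpace C_AbsRing) (@locally (AbsRing_UniformSpace C_AbsRing) z) z) by (intros P HP; exact HP).
  destruct (H z Hl (mkposreal eps Heps)) as [d Hd].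
  exists d; split; [apply cond_pos|].
  intros w Hw. apply (Hd w Hw).
- intros H. split; [apply is_linear_scal_l|].
  intros x Hx.
  replace x with z by (apply (@is_filter_lim_locally_unique C_AbsRing (AbsRing_NormedModule C_AbsRing) z x); exact Hx).
  intros eps. destruct (H eps (cond_pos eps)) as [d [Hd Hw]].
  exists (mkposreal d Hd). intros y Hy. apply (Hw y Hy).
Qed.

(** The field C carries two normed-module structures with the same norm; products and compositions
    are differentiated over the one, entire functions are defined over the other. *)
Lemma is_cderive_absring (f : C -> C) (z l : C) :
  is_cderive f z l <-> @is_derive C_AbsRing (AbsRing_NormedModule C_AbsRing) f z l.
Proof.
split; intros [_ H]; (split; [apply is_linear_scal_l|exact H]).
Qed.

Lemma cdiff_const (a z : C) : cdiff (fun _ => a) z.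
Proof. apply ex_derive_const. Qed.
Lemma cdiff_id (z : C) : cdiff (fun w => w) z.
Proof. exists (RtoC 1). apply is_cderive_absring, (is_derive_id (K := C_AbsRing)). Qed.
Lemma is_cderive_plus f g z l m : is_cderive f z l -> is_cderive g z m ->
  is_cderive (fun w => f w + g w)%C z (l + m)%C.
Proof. apply (is_derive_plus (K := C_AbsRing) (V := C_NormedModule)). Qed.
Lemma is_cderive_mult f g z l m : is_cderive f z l -> is_cderive g z m ->
  is_cderive (fun w => f w * g w)%C z (l * g z + f z * m)%C.
Proof.
rewrite !is_cderive_absring. intros Hf Hg.
apply (is_derive_mult (K := C_AbsRing) f g z l m Hf Hg). exact Cmult_comm.
Qed.
Lemma is_cderive_comp (f g : C -> C) z l m : is_cderive f (g z) l -> is_cderive g z m ->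
  is_cderive (fun w => f (g w)) z (m * l)%C.
Proof.
rewrite (is_cderive_absring g). apply (is_derive_comp (K := C_AbsRing) (V := C_NormedModule)).
Qed.
Lemma cdiff_plus f g z : cdiff f z -> cdiff g z -> cdiff (fun w => f w + g w)%C z.
Proof. intros [l Hl] [m Hm]. eexists. apply is_cderive_plus; eassumption. Qed.
Lemma cdiff_mult f g z : cdiff f z -> cdiff g z -> cdiff (fun w => f w * g w)%C z.
Proof. intros [l Hl] [m Hm]. eexists. apply is_cderive_mult; eassumption. Qed.
Lemma cdiff_comp (f g : C -> C) z : cdiff f (g z) -> cdiff g z -> cdiff (fun w => f (g w)) z.
Proof. intros [l Hl] [m Hm]. eexists. apply is_cderive_comp; eassumption. Qed.
Lemma cdiff_opp f z : cdiff f z -> cdiff (fun w => - f w)%C z.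
Proof. apply (ex_derive_opp (K := C_AbsRing) (V := C_NormedModule)). Qed.
Lemma cdiff_minus f g z : cdiff f z -> cdiff g z -> cdiff (fun w => f w - g w)%C z.
Proof. intros. apply cdiff_plus; [|apply cdiff_opp]; assumption. Qed.
Lemma cdiff_pow f n z : cdiff f z -> cdiff (fun w => f w ^ n)%C z.
Proof.
intros H. induction n as [|n IH]; simpl. apply cdiff_const. apply cdiff_mult; assumption.
Qed.
Lemma cdiff_ext_loc f g z r : 0 < r -> (forall w, Cmod (w - z) < r -> f w = g w) ->
  cdiff f z -> cdiff g z.
Proof.
intros Hr H. apply (ex_derive_ext_loc (K := C_AbsRing) (V := C_NormedModule)).
exists (mkposreal r Hr). intros w Hw. apply H, Hw.
Qed.

Definition ccont (f : C -> C) (z : C) := forall eps, 0 < eps -> exists delta, 0 < delta /\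
  forall w, Cmod (w - z) < delta -> Cmod (f w - f z) < eps.

Lemma cdiff_cont f z : cdiff f z -> ccont f z.
Proof.
intros [l Hl] eps Heps.
rewrite is_cderive_eps in Hl. destruct (Hl 1 Rlt_0_1) as [d [Hd H]].
assert (Hm := Cmod_ge_0 l).
exists (Rmin d (eps / (2 + Cmod l))). split.
{ apply Rmin_pos; [assumption|]. apply Rdiv_lt_0_compat; lra. }
intros w Hw. specialize (H w (Rlt_le_trans _ _ _ Hw (Rmin_l _ _))).
assert (Hw2 := Rlt_le_trans _ _ _ Hw (Rmin_r _ _)).
replace (f w - f z)%C with ((f w - f z - (w - z) * l) + (w - z) * l)%C by ring.
eapply Rle_lt_trans. apply Cmod_triangle. rewrite Cmod_mult.
assert (Cmod (w - z) * (2 + Cmod l) < eps).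
{ apply (Rmult_lt_compat_r (2 + Cmod l)) in Hw2; [|lra].
  unfold Rdiv in Hw2. rewrite Rmult_assoc, Rinv_l in Hw2; lra. }
assert (0 <= Cmod (w - z)) by apply Cmod_ge_0. nra.
Qed.

Lemma is_cderive_inv (z : C) : z <> 0%C -> is_cderive (fun w => / w)%C z (- / (z * z))%C.
Proof.
intros Hz. apply is_cderive_eps. intros eps Heps.
assert (Hmz := proj1 (Cmod_gt_0 z) Hz). set (m := Cmod z) in *.
exists (Rmin (m / 2) (eps * m ^ 3 / 2)). split.
{ apply Rmin_pos; [lra|]. apply Rdiv_lt_0_compat; [|lra]. apply Rmult_lt_0_compat; [lra|]. apply pow_lt; lra. }
intros w Hw. assert (H1 := Rlt_le_trans _ _ _ Hw (Rmin_l _ _)).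
assert (H2 := Rlt_le_trans _ _ _ Hw (Rmin_r _ _)).
assert (Hmw : m / 2 < Cmod w).
{ assert (m <= Cmod w + Cmod (w - z)).
  { unfold m. replace z with (w + - (w - z))%C at 1 by ring. eapply Rle_trans; [apply Cmod_triangle|]. rewrite Cmod_opp. lra. }
  lra. }
assert (Hw0 : w <> 0%C) by (apply Cmod_gt_0; lra).
replace (/ w - / z - (w - z) * - / (z * z))%C with ((w - z) * ((w - z) * / (w * (z * z))))%C
  by (field; auto).
rewrite Cmod_mult, Rmult_comm. apply Rmult_le_compat_r; [apply Cmod_ge_0|].
rewrite Cmod_mult, Cmod_inv, !Cmod_mult. 2: repeat apply Cmult_neq_0; auto.
fold m. apply Rle_div_l. { apply Rmult_lt_0_compat; nra. }
assert (0 < m * m) by nra.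
assert (eps * m ^ 3 / 2 <= eps * (Cmod w * (m * m))); [|lra].
replace (eps * m ^ 3 / 2) with (eps * (m/2 * (m * m))) by field.
apply Rmult_le_compat_l; [lra|]. apply Rmult_le_compat_r; lra.
Qed.
Lemma cdiff_inv f z : cdiff f z -> f z <> RtoC 0 -> cdiff (fun w => / f w)%C z.
Proof.
intros Hf H0. apply (cdiff_comp (fun w => / w)%C f); [|assumption].
eexists. apply is_cderive_inv, H0.
Qed.
Lemma cdiff_div f g z : cdiff f z -> cdiff g z -> g z <> RtoC 0 -> cdiff (fun w => f w / g w)%C z.
Proof. intros. apply cdiff_mult; [assumption|]. apply cdiff_inv; assumption. Qed.

Lemma cdiff_conj (f : C -> C) (z : C) : cdiff f (Cconj z) -> cdiff (fun w => Cconj (f (Cconj w))) z.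
Proof.
intros [l Hl]. exists (Cconj l). rewrite is_cderive_eps in *. intros eps Heps.
destruct (Hl eps Heps) as [d [Hd H]]. exists d; split; [assumption|]. intros w Hw.
rewrite <- (Cmod_conj (w - z)), Cminus_conj in *. specialize (H _ Hw).
rewrite <- Cmod_conj in H. rewrite !Cminus_conj, Cmult_conj, Cminus_conj, !Cconj_conj in H. exact H.
Qed.

Definition cexp (z : C) : C := (exp (Re z) * cos (Im z), exp (Re z) * sin (Im z)).
Lemma cexp_plus (a b : C) : cexp (a + b) = (cexp a * cexp b)%C.
Proof.
unfold cexp. destruct a as [a1 a2], b as [b1 b2]. apply injective_projections; simpl;
rewrite exp_plus, ?cos_plus, ?sin_plus; ring.
Qed.
Lemma Cmod_cexp (z : C) : Cmod (cexp z) = exp (Re z).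
Proof.
unfold Cmod, cexp. simpl fst; simpl snd.
replace ((exp (Re z) * cos (Im z)) ^ 2 + (exp (Re z) * sin (Im z)) ^ 2) with (exp (Re z) ^ 2).
- apply sqrt_pow2, Rlt_le, exp_pos.
- assert (H := sin2_cos2 (Im z)). unfold Rsqr in H. nra.
Qed.
Lemma cexp_0 : cexp 0 = 1%C.
Proof. unfold cexp; simpl. rewrite exp_0, cos_0, sin_0. apply injective_projections; simpl; ring. Qed.
Lemma Cmod_le_abs (z : C) : Cmod z <= Rabs (Re z) + Rabs (Im z).
Proof.
unfold Cmod. fold (Re z) (Im z).
assert (H1 := Rabs_pos (Re z)). assert (H2 := Rabs_pos (Im z)).
rewrite <- (sqrt_Rsqr (Rabs (Re z) + Rabs (Im z))) by lra.
apply sqrt_le_1_alt. unfold Rsqr. rewrite <- (pow2_abs (Re z)), <- (pow2_abs (Im z)). nra.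
Qed.
Lemma im_le_Cmod (z : C) : Rabs (Im z) <= Cmod z.
Proof. eapply Rle_trans; [|apply Rmax_Cmod]. apply Rmax_r. Qed.

Lemma real_derive_eps f x l : is_derive f x l -> forall eps, 0 < eps -> exists d, 0 < d /\
  forall h, Rabs h < d -> Rabs (f (x + h) - f x - l * h) <= eps * Rabs h.
Proof.
intros Hf eps Heps. apply is_derive_Reals in Hf. destruct (Hf eps Heps) as [d Hd].
exists d. split; [apply cond_pos|]. intros h Hh.
destruct (Req_dec h 0) as [->|Hn].
- rewrite Rplus_0_r, Rminus_diag, Rmult_0_r, Rminus_0_r, Rabs_R0. lra.
- specialize (Hd h Hn Hh).
  replace (f (x + h) - f x - l * h) with (((f (x + h) - f x) / h - l) * h) by (field; auto).
  rewrite Rabs_mult. apply Rmult_le_compat_r; [apply Rabs_pos|lra].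
Qed.

Lemma is_cderive_exp (z : C) : is_cderive cexp z (cexp z).
Proof.
assert (H0 : is_cderive cexp (RtoC 0) (RtoC 1)).
{ apply is_cderive_eps. intros eps Heps.
  set (e := Rmin (eps / 8) 1).
  assert (He : 0 < e) by (apply Rmin_pos; lra).
  assert (He1 : e <= eps / 8) by apply Rmin_l. assert (He2 : e <= 1) by apply Rmin_r.
  assert (Dexp : is_derive exp 0 1) by (auto_derive; [auto|rewrite exp_0; ring]).
  assert (Dcos : is_derive cos 0 0) by (auto_derive; [auto|rewrite sin_0; ring]).
  assert (Dsin : is_derive sin 0 1) by (auto_derive; [auto|rewrite cos_0; ring]).
  destruct (real_derive_eps _ _ _ Dexp e He) as [d1 [Hd1 K1]].
  destruct (real_derive_eps _ _ _ Dcos e He) as [d2 [Hd2 K2]].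
  destruct (real_derive_eps _ _ _ Dsin e He) as [d3 [Hd3 K3]].
  exists (Rmin (Rmin d1 d2) (Rmin d3 (e/2))). split.
  { repeat apply Rmin_pos; lra. }
  intros w Hw.
  assert (Ew : (w - 0 = w)%C) by ring. rewrite Ew in *.
  assert (L1 := Rle_lt_trans _ _ _ (re_le_Cmod w) Hw).
  assert (L2 := Rle_lt_trans _ _ _ (im_le_Cmod w) Hw).
  set (m := Cmod w) in *. assert (M1 : Rabs (Re w) <= m) by apply re_le_Cmod.
  assert (M2 : Rabs (Im w) <= m) by apply im_le_Cmod.
  assert (m < e / 2) by (eapply Rlt_le_trans; [exact Hw|]; eapply Rle_trans; apply Rmin_r).
  assert (A1 : Rmin (Rmin d1 d2) (Rmin d3 (e/2)) <= d1) by (eapply Rle_trans; [apply Rmin_l|]; apply Rmin_l).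
  assert (A2 : Rmin (Rmin d1 d2) (Rmin d3 (e/2)) <= d2) by (eapply Rle_trans; [apply Rmin_l|]; apply Rmin_r).
  assert (A3 : Rmin (Rmin d1 d2) (Rmin d3 (e/2)) <= d3) by (eapply Rle_trans; [apply Rmin_r|]; apply Rmin_l).
  specialize (K1 (Re w) ltac:(lra)). specialize (K2 (Im w) ltac:(lra)). specialize (K3 (Im w) ltac:(lra)).
  rewrite Rplus_0_l in K1, K2, K3. rewrite exp_0 in K1. rewrite cos_0 in K2. rewrite sin_0 in K3.
  assert (m0 : 0 <= m) by apply Cmod_ge_0.
  assert (K1' : Rabs (exp (Re w) - 1 - 1 * Re w) <= e * m) by nra.
  assert (K2' : Rabs (cos (Im w) - 1 - 0 * Im w) <= e * m) by nra.
  assert (K3' : Rabs (sin (Im w) - 0 - 1 * Im w) <= e * m) by nra.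
  apply Rabs_le_between in K1', K2', K3'.
  apply Rabs_le_between in M1, M2.
  eapply Rle_trans; [apply Cmod_le_abs|].
  assert (E0 := exp_pos (Re w)).
  assert (Eb : -(2 * m) <= exp (Re w) - 1 <= 2 * m) by nra.
  assert (X1 : Rabs (Re (cexp w - cexp 0 - w * 1)%C) <= 4 * e * m).
  { rewrite cexp_0. unfold cexp, Re, Im in *; simpl.
    replace (exp (fst w) * cos (snd w) + -1 + - (fst w * 1 - snd w * 0)) with
      ((exp (fst w) - 1 - fst w) + (exp (fst w)) * (cos (snd w) - 1)) by ring.
    assert (exp (fst w) <= 2) by lra.
    apply Rabs_le. assert (0 <= e * m) by nra. split; nra. }
  assert (X2 : Rabs (Im (cexp w - cexp 0 - w * 1)%C) <= 4 * e * m).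
  { rewrite cexp_0. unfold cexp, Re, Im in *; simpl.
    replace (exp (fst w) * sin (snd w) + - 0 + - (fst w * 0 + snd w * 1)) with
      ((sin (snd w) - snd w) + (exp (fst w) - 1) * sin (snd w)) by ring.
    assert (-(2*m) <= sin (snd w) <= 2 * m) by nra.
    assert (0 <= e * m) by nra.
    apply Rabs_le. split; nra. }
  nra. }
assert (H1 : is_cderive (fun w => cexp z * cexp (w - z))%C z (cexp z)).
{ assert (H2 : is_cderive (fun w => cexp (w - z))%C z (RtoC 1)).
  { replace (RtoC 1) with (1 * 1)%C by ring. apply (is_cderive_comp cexp (fun w => w - z)%C).
    - replace (z - z)%C with (RtoC 0) by ring. exact H0.
    - apply is_cderive_eps. intros eps He. exists 1; split; [lra|]. intros w _.
      replace (w - z - (z - z) - (w - z) * 1)%C with (RtoC 0) by ring. rewrite Cmod_0.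
      apply Rmult_le_pos; [lra|apply Cmod_ge_0]. }
  assert (H3 : is_cderive (fun _ => cexp z) z (RtoC 0))
    by apply (is_derive_const (K := C_AbsRing) (V := C_NormedModule)).
  assert (H4 := is_cderive_mult _ _ _ _ _ H3 H2). simpl in H4.
  assert (E : (0 * cexp (z - z) + cexp z * 1)%C = cexp z) by ring.
  rewrite E in H4. exact H4. }
eapply is_derive_ext; [|exact H1]. intros t. simpl. rewrite <- cexp_plus. f_equal. ring.
Qed.
Lemma cdiff_exp f z : cdiff f z -> cdiff (fun w => cexp (f w)) z.
Proof. intros H. apply (cdiff_comp cexp f); [|exact H]. eexists. apply is_cderive_exp. Qed.

Lemma cdiff_cexp (z : C) : cdiff cexp z.
Proof. eexists. apply is_cderive_exp. Qed.

Ltac prove_cdiff :=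
  lazymatch goal with
  | |- ex_derive (fun w => w) _ => apply cdiff_id
  | |- ex_derive cexp _ => apply cdiff_cexp
  | |- ex_derive (fun w => Cplus (@?f w) (@?g w)) _ => apply (cdiff_plus f g); prove_cdiff
  | |- ex_derive (fun w => Cminus (@?f w) (@?g w)) _ => apply (cdiff_minus f g); prove_cdiff
  | |- ex_derive (fun w => Cmult (@?f w) (@?g w)) _ => apply (cdiff_mult f g); prove_cdiff
  | |- ex_derive (fun w => Copp (@?f w)) _ => apply (cdiff_opp f); prove_cdiff
  | |- ex_derive (fun w => Cpow (@?f w) ?n) _ => apply (cdiff_pow f n); prove_cdiff
  | |- ex_derive (fun w => cexp (@?f w)) _ => apply (cdiff_exp f); prove_cdiff
  | |- ex_derive (fun w => ?a) _ => first [exact (cdiff_const a _) | auto]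
  | _ => auto
  end.


(** * Bisection of rectangles and Goursat's theorem *)

Lemma nested_point (a b : nat -> R) :
  (forall n, a n <= a (S n)) -> (forall n, b (S n) <= b n) -> (forall n, a n <= b n) ->
  exists x, forall n, a n <= x <= b n.
Proof.
intros Ha Hb Hab.
assert (Ma : forall n k, a n <= a (n + k)%nat).
{ intros n k. induction k as [|k IH]. rewrite Nat.add_0_r; lra. rewrite Nat.add_succ_r. specialize (Ha (n + k)%nat). lra. }
assert (Mb : forall n k, b (n + k)%nat <= b n).
{ intros n k. induction k as [|k IH]. rewrite Nat.add_0_r; lra. rewrite Nat.add_succ_r. specialize (Hb (n + k)%nat). lra. }
assert (Hc : forall m n, a m <= b n).
{ intros m n. assert (H1 := Ma m n). assert (H2 := Mb n m). specialize (Hab (m + n)%nat).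
  rewrite (Nat.add_comm n m) in H2. lra. }
destruct (completeness (fun y => exists n, y = a n)) as [x [Hx1 Hx2]].
- exists (b O). intros y [n ->]. apply Hc.
- exists (a O), O. reflexivity.
- exists x. intros n. split; [apply Hx1; exists n; reflexivity|]. apply Hx2. intros y [m ->]. apply Hc.
Qed.

Lemma pow2_small (L delta : R) : 0 < delta -> exists n, L / 2 ^ n < delta.
Proof.
intros Hd. destruct (Rle_lt_dec L 0) as [HL|HL].
- exists O. simpl. lra.
- assert (Hr : Rabs (/ 2) < 1) by (rewrite Rabs_pos_eq; lra).
  destruct (pow_lt_1_zero (/ 2) Hr (delta / L)) as [N HN].
  { apply Rdiv_lt_0_compat; assumption. }
  exists N. specialize (HN N (le_n N)). rewrite pow_inv in HN.
  rewrite Rabs_pos_eq in HN. 2: { apply Rlt_le, Rinv_0_lt_compat, pow_lt; lra. }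
  apply (Rmult_lt_compat_l L) in HN; [|assumption].
  replace (L * (delta / L)) with delta in HN by (field; lra). exact HN.
Qed.

(** A property that passes from the four quarters to the whole, and holds for all small rectangles
    around each point, holds: otherwise repeated bisection yields rectangles without the property
    that shrink to a point. *)
Lemma rectangle_bisection (P : R -> R -> R -> R -> Prop) (a b c d : R) :
  a <= b -> c <= d ->
  (forall a b c d, a <= b -> c <= d ->
     P a ((a + b) / 2) c ((c + d) / 2) -> P ((a + b) / 2) b c ((c + d) / 2) ->
     P a ((a + b) / 2) ((c + d) / 2) d -> P ((a + b) / 2) b ((c + d) / 2) d ->
     P a b c d) ->
  (forall x y, a <= x <= b -> c <= y <= d -> exists delta, 0 < delta /\
     forall a' b' c' d', a <= a' <= x -> x <= b' <= b -> c <= c' <= y -> y <= d' <= d ->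
       b' - a' < delta -> d' - c' < delta -> P a' b' c' d') ->
  P a b c d.
Proof.
intros Hab Hcd Hglue Hloc. apply NNPP. intros HP.
set (T := (R * R * (R * R))%type).
set (lo1 := fun t : T => fst (fst t)). set (hi1 := fun t : T => snd (fst t)).
set (lo2 := fun t : T => fst (snd t)). set (hi2 := fun t : T => snd (snd t)).
set (bad := fun t : T => lo1 t <= hi1 t /\ lo2 t <= hi2 t /\ ~ P (lo1 t) (hi1 t) (lo2 t) (hi2 t)).
set (half := fun t s : T => lo1 t <= lo1 s /\ hi1 s <= hi1 t /\ lo2 t <= lo2 s /\ hi2 s <= hi2 t /\
  hi1 s - lo1 s = (hi1 t - lo1 t) / 2 /\ hi2 s - lo2 s = (hi2 t - lo2 t) / 2).
assert (Hstep : forall t, exists s, bad t -> bad s /\ half t s).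
{ intros t. destruct (classic (bad t)) as [Hb|Hb]; [|exists t; tauto].
  destruct Hb as (H1 & H2 & H3).
  destruct t as [[a1 b1] [c1 d1]]. unfold lo1, hi1, lo2, hi2 in H1, H2, H3; simpl in H1, H2, H3.
  assert (Hq : ~ P a1 ((a1 + b1) / 2) c1 ((c1 + d1) / 2) \/ ~ P ((a1 + b1) / 2) b1 c1 ((c1 + d1) / 2) \/
     ~ P a1 ((a1 + b1) / 2) ((c1 + d1) / 2) d1 \/ ~ P ((a1 + b1) / 2) b1 ((c1 + d1) / 2) d1).
  { specialize (Hglue a1 b1 c1 d1 H1 H2). tauto. }
  destruct Hq as [Hq|[Hq|[Hq|Hq]]].
  - exists ((a1, (a1 + b1) / 2), (c1, (c1 + d1) / 2)). intros _.
    unfold bad, half, lo1, hi1, lo2, hi2; simpl. repeat split; try lra. exact Hq.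
  - exists (((a1 + b1) / 2, b1), (c1, (c1 + d1) / 2)). intros _.
    unfold bad, half, lo1, hi1, lo2, hi2; simpl. repeat split; try lra. exact Hq.
  - exists ((a1, (a1 + b1) / 2), ((c1 + d1) / 2, d1)). intros _.
    unfold bad, half, lo1, hi1, lo2, hi2; simpl. repeat split; try lra. exact Hq.
  - exists (((a1 + b1) / 2, b1), ((c1 + d1) / 2, d1)). intros _.
    unfold bad, half, lo1, hi1, lo2, hi2; simpl. repeat split; try lra. exact Hq. }
set (step := fun t => proj1_sig (constructive_indefinite_description _ (Hstep t))).
assert (Hs : forall t, bad t -> bad (step t) /\ half t (step t)).
{ intros t. exact (proj2_sig (constructive_indefinite_description _ (Hstep t))). }
set (r := fun n => Nat.iter n step ((a, b), (c, d))).
assert (Hbad : forall n, bad (r n)).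
{ intros n. induction n as [|n IH].
  - unfold r, bad, lo1, hi1, lo2, hi2; simpl. repeat split; assumption.
  - apply (Hs (r n) IH). }
assert (Hhalf : forall n, half (r n) (r (S n))) by (intros n; apply (Hs (r n) (Hbad n))).
destruct (nested_point (fun n => lo1 (r n)) (fun n => hi1 (r n))) as [x Hx].
{ intros n; apply Hhalf. } { intros n; apply Hhalf. } { intros n; apply Hbad. }
destruct (nested_point (fun n => lo2 (r n)) (fun n => hi2 (r n))) as [y Hy].
{ intros n; apply Hhalf. } { intros n; apply Hhalf. } { intros n; apply Hbad. }
assert (Hin : forall n, a <= lo1 (r n) /\ hi1 (r n) <= b /\ c <= lo2 (r n) /\ hi2 (r n) <= d /\
   hi1 (r n) - lo1 (r n) = (b - a) / 2 ^ n /\ hi2 (r n) - lo2 (r n) = (d - c) / 2 ^ n).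
{ intros n. induction n as [|n IH].
  - unfold r, lo1, hi1, lo2, hi2; simpl. repeat split; try lra; field.
  - destruct (Hhalf n) as (K1 & K2 & K3 & K4 & K5 & K6). destruct IH as (I1 & I2 & I3 & I4 & I5 & I6).
    repeat split; try lra.
    + rewrite K5, I5. simpl. field. apply pow_nonzero; lra.
    + rewrite K6, I6. simpl. field. apply pow_nonzero; lra. }
assert (Hx0 := Hx O). assert (Hy0 := Hy O). unfold r, lo1, hi1, lo2, hi2 in Hx0, Hy0; simpl in Hx0, Hy0.
destruct (Hloc x y Hx0 Hy0) as [delta [Hd HD]].
destruct (pow2_small (b - a + (d - c)) delta Hd) as [n Hn].
assert (Hp : 0 < / 2 ^ n) by (apply Rinv_0_lt_compat, pow_lt; lra).
unfold Rdiv in Hn.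
apply (proj2 (proj2 (Hbad n))).
destruct (Hin n) as (I1 & I2 & I3 & I4 & I5 & I6). specialize (Hx n). specialize (Hy n). simpl in Hx, Hy.
unfold Rdiv in I5, I6.
apply HD; try lra; nra.
Qed.

(** The property to bisect is: some point of the big rectangle dominates the small one. *)
Lemma rectangle_max (phi : C -> R) (a b c d : R) : a <= b -> c <= d ->
  (forall x y, a <= x <= b -> c <= y <= d -> forall eps, 0 < eps -> exists delta, 0 < delta /\
     forall w, Cmod (w - (x, y)) < delta -> Rabs (phi w - phi (x, y)) < eps) ->
  exists x y, a <= x <= b /\ c <= y <= d /\
    forall x' y', a <= x' <= b -> c <= y' <= d -> phi (x', y') <= phi (x, y).
Proof.
intros Hab Hcd Hc.
apply (rectangle_bisection (fun a' b' c' d' => exists x y, a <= x <= b /\ c <= y <= d /\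
  forall x' y', a' <= x' <= b' -> c' <= y' <= d' -> phi (x', y') <= phi (x, y))); try assumption.
- intros a' b' c' d' H1 H2.
  intros (x1 & y1 & X1 & Y1 & M1) (x2 & y2 & X2 & Y2 & M2) (x3 & y3 & X3 & Y3 & M3) (x4 & y4 & X4 & Y4 & M4).
  assert (Hm : exists x y, a <= x <= b /\ c <= y <= d /\ phi (x1, y1) <= phi (x, y) /\
    phi (x2, y2) <= phi (x, y) /\ phi (x3, y3) <= phi (x, y) /\ phi (x4, y4) <= phi (x, y)).
  { destruct (Rle_dec (phi (x1, y1)) (phi (x2, y2))), (Rle_dec (phi (x3, y3)) (phi (x4, y4))),
     (Rle_dec (phi (x1, y1)) (phi (x3, y3))), (Rle_dec (phi (x1, y1)) (phi (x4, y4))),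
     (Rle_dec (phi (x2, y2)) (phi (x3, y3))), (Rle_dec (phi (x2, y2)) (phi (x4, y4)));
   first [exists x1, y1; repeat split; lra | exists x2, y2; repeat split; lra |
     exists x3, y3; repeat split; lra | exists x4, y4; repeat split; lra]. }
  destruct Hm as (x & y & X & Y & N1 & N2 & N3 & N4). exists x, y. repeat split; try lra.
  intros x' y' Hx' Hy'.
  destruct (Rle_dec x' ((a' + b') / 2)), (Rle_dec y' ((c' + d') / 2)).
  + eapply Rle_trans; [apply M1; lra|lra].
  + eapply Rle_trans; [apply M3; lra|lra].
  + eapply Rle_trans; [apply M2; lra|lra].
  + eapply Rle_trans; [apply M4; lra|lra].
- intros x y Hx Hy.
  destruct (classic (exists x' y', a <= x' <= b /\ c <= y' <= d /\ phi (x, y) < phi (x', y'))) as [H|H].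
  + destruct H as (x' & y' & Hx' & Hy' & Hlt).
    destruct (Hc x y Hx Hy (phi (x', y') - phi (x, y))) as [delta [Hd HD]]; [lra|].
    exists (delta / 2). split; [lra|]. intros a' b' c' d' A B C' D W1 W2.
    exists x', y'. split; [assumption|]. split; [assumption|]. intros x2 y2 Hx2 Hy2.
    assert (Hw : Cmod ((x2, y2) - (x, y)) < delta).
    { eapply Rle_lt_trans; [apply Cmod_le_abs|]. simpl.
      assert (Rabs (x2 + - x) < delta / 2) by (apply Rabs_def1; lra).
      assert (Rabs (y2 + - y) < delta / 2) by (apply Rabs_def1; lra). lra. }
    specialize (HD _ Hw). apply Rabs_def2 in HD. lra.
  + exists 1. split; [lra|]. intros a' b' c' d' A B C' D W1 W2. exists x, y.
    split; [assumption|]. split; [assumption|]. intros x2 y2 Hx2 Hy2.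
    apply Rnot_lt_le. intros Hlt. apply H. exists x2, y2. repeat split; try lra.
Qed.

Lemma continuous_eps (f : R -> R) (x : R) : continuous f x <->
  forall eps, 0 < eps -> exists delta, 0 < delta /\
    forall y, Rabs (y - x) < delta -> Rabs (f y - f x) < eps.
Proof.
split.
- intros H eps Heps.
  destruct (proj1 (filterlim_locally _ _) H (mkposreal eps Heps)) as [delta Hd].
  exists delta. split; [apply cond_pos|]. intros y Hy. apply (Hd y Hy).
- intros H. apply filterlim_locally. intros eps.
  destruct (H eps (cond_pos eps)) as [delta [Hd HD]].
  exists (mkposreal delta Hd). intros y Hy. apply (HD y Hy).
Qed.

Lemma continuous_along_path (f : C -> C) (g : R -> C) (t : R) :
  ccont f (g t) -> continuous (fun s => Re (g s)) t -> continuous (fun s => Im (g s)) t ->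
  continuous (fun s => Re (f (g s))) t /\ continuous (fun s => Im (f (g s))) t.
Proof.
intros Hf Hr Hi.
assert (H : forall eps, 0 < eps -> exists delta, 0 < delta /\
  forall u, Rabs (u - t) < delta -> Cmod (f (g u) - f (g t)) < eps).
{ intros eps Heps. destruct (Hf eps Heps) as [d [Hd HD]].
  destruct (proj1 (continuous_eps _ _) Hr (d / 2)) as [d1 [Hd1 K1]]; [lra|].
  destruct (proj1 (continuous_eps _ _) Hi (d / 2)) as [d2 [Hd2 K2]]; [lra|].
  exists (Rmin d1 d2). split; [apply Rmin_pos; assumption|]. intros u Hu.
  specialize (K1 u (Rlt_le_trans _ _ _ Hu (Rmin_l _ _))).
  specialize (K2 u (Rlt_le_trans _ _ _ Hu (Rmin_r _ _))).
  apply HD. eapply Rle_lt_trans; [apply Cmod_le_abs|].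
  simpl. unfold Re, Im in K1, K2. unfold Rminus in K1, K2. lra. }
split; apply continuous_eps; intros eps Heps; destruct (H eps Heps) as [d [Hd HD]];
exists d; (split; [assumption|]); intros u Hu; (eapply Rle_lt_trans; [|exact (HD u Hu)]).
- apply (re_le_Cmod (f (g u) - f (g t))).
- apply (im_le_Cmod (f (g u) - f (g t))).
Qed.

(** The real part of the integral of f(z) dz along the boundary of the rectangle; the imaginary part
    is the real part for - i f. *)
Definition rect_form (f : C -> C) (a b c d : R) : R :=
  RInt (fun x => Re (f (x, c)) - Re (f (x, d))) a b
  - RInt (fun y => Im (f (b, y)) - Im (f (a, y))) c d.

Lemma cont_horizontal (f : C -> C) x y : ccont f (x, y) -> continuous (fun t => Re (f (t, y))) x.
Proof.
intros H. apply (continuous_along_path f (fun t => (t, y)) x H).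
- apply continuous_id. - apply continuous_const.
Qed.
Lemma cont_vertical (f : C -> C) x y : ccont f (x, y) -> continuous (fun t => Im (f (x, t))) y.
Proof.
intros H. apply (continuous_along_path f (fun t => (x, t)) y H).
- apply continuous_const. - apply continuous_id.
Qed.

Lemma integrable_horizontal (f : C -> C) a b c d :
  a <= b -> (forall x, a <= x <= b -> ccont f (x, c) /\ ccont f (x, d)) ->
  ex_RInt (fun x => Re (f (x, c)) - Re (f (x, d))) a b.
Proof.
intros Hab H. apply (ex_RInt_continuous (V := R_CompleteNormedModule)). intros x.
rewrite Rmin_left, Rmax_right by lra. intros Hx.
apply (continuous_minus (V := R_NormedModule)); apply cont_horizontal, H, Hx.
Qed.
Lemma integrable_vertical (f : C -> C) a b c d :
  c <= d -> (forall y, c <= y <= d -> ccont f (a, y) /\ ccont f (b, y)) ->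
  ex_RInt (fun y => Im (f (b, y)) - Im (f (a, y))) c d.
Proof.
intros Hcd H. apply (ex_RInt_continuous (V := R_CompleteNormedModule)). intros y.
rewrite Rmin_left, Rmax_right by lra. intros Hy.
apply (continuous_minus (V := R_NormedModule)); apply cont_vertical, H, Hy.
Qed.

Lemma RInt_dist_const (g : R -> R) (a b k e : R) : a <= b -> ex_RInt g a b ->
  (forall x, a <= x <= b -> Rabs (g x - k) <= e) -> Rabs (RInt g a b - (b - a) * k) <= (b - a) * e.
Proof.
intros Hab Hex H.
assert (L : RInt (fun _ => k - e) a b <= RInt g a b).
{ apply RInt_le; [assumption|apply ex_RInt_const|assumption|].
  intros x Hx. specialize (H x ltac:(lra)). apply Rabs_le_between in H. lra. }
assert (U : RInt g a b <= RInt (fun _ => k + e) a b).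
{ apply RInt_le; [assumption|assumption|apply ex_RInt_const|].
  intros x Hx. specialize (H x ltac:(lra)). apply Rabs_le_between in H. lra. }
rewrite RInt_const in L, U. unfold scal in L, U; simpl in L, U. unfold mult in L, U; simpl in L, U.
apply Rabs_le. lra.
Qed.

Definition cont_on (f : C -> C) a b c d := forall x y, a <= x <= b -> c <= y <= d -> ccont f (x, y).

Lemma rect_form_split_x f a m b c d : a <= m <= b -> c <= d -> cont_on f a b c d ->
  rect_form f a b c d = rect_form f a m c d + rect_form f m b c d.
Proof.
intros Hm Hcd H. unfold rect_form.
rewrite <- (RInt_Chasles (fun x => Re (f (x, c)) - Re (f (x, d))) a m b).
2,3: apply integrable_horizontal; [lra|]; intros x Hx; split; apply H; lra.
assert (E : RInt (fun y => Im (f (b, y)) - Im (f (a, y))) c d =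
  plus (RInt (fun y => Im (f (m, y)) - Im (f (a, y))) c d) (RInt (fun y => Im (f (b, y)) - Im (f (m, y))) c d)).
{ rewrite <- (RInt_plus (V := R_CompleteNormedModule)).
  2,3: apply integrable_vertical; [lra|]; intros y Hy; split; apply H; lra.
  apply RInt_ext. intros y _. unfold plus; simpl. ring. }
rewrite E. unfold plus; simpl. ring.
Qed.
Lemma rect_form_split_y f a b c m d : a <= b -> c <= m <= d -> cont_on f a b c d ->
  rect_form f a b c d = rect_form f a b c m + rect_form f a b m d.
Proof.
intros Hab Hm H. unfold rect_form.
rewrite <- (RInt_Chasles (fun y => Im (f (b, y)) - Im (f (a, y))) c m d).
2,3: apply integrable_vertical; [lra|]; intros x Hx; split; apply H; lra.
assert (E : RInt (fun x => Re (f (x, c)) - Re (f (x, d))) a b =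
  plus (RInt (fun x => Re (f (x, c)) - Re (f (x, m))) a b) (RInt (fun x => Re (f (x, m)) - Re (f (x, d))) a b)).
{ rewrite <- (RInt_plus (V := R_CompleteNormedModule)).
  2,3: apply integrable_horizontal; [lra|]; intros y Hy; split; apply H; lra.
  apply RInt_ext. intros y _. unfold plus; simpl. ring. }
rewrite E. unfold plus; simpl. ring.
Qed.

(** The affine part l (z - p) contributes Im l times the area to each of the two integrals, hence
    nothing to their difference; the rest is at most the perimeter times eps times the diameter. *)
Lemma rect_form_local f x y l eps a b c d : 0 <= eps ->
  a <= x <= b -> c <= y <= d -> cont_on f a b c d ->
  (forall w, a <= Re w <= b -> c <= Im w <= d ->
    Cmod (f w - f (x, y) - (w - (x, y)) * l)%C <= eps * Cmod (w - (x, y))) ->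
  Rabs (rect_form f a b c d) <= 4 * eps * ((b - a) ^ 2 + (d - c) ^ 2).
Proof.
intros He Hx Hy Hc H.
set (L := b - a + (d - c)).
assert (HL : forall w, a <= Re w <= b -> c <= Im w <= d ->
  Rabs (Re (f w - f (x, y) - (w - (x, y)) * l)%C) <= eps * L /\
  Rabs (Im (f w - f (x, y) - (w - (x, y)) * l)%C) <= eps * L).
{ intros w H1 H2. assert (Hle : Cmod (f w - f (x, y) - (w - (x, y)) * l)%C <= eps * L).
  { eapply Rle_trans; [apply H; assumption|]. apply Rmult_le_compat_l; [assumption|].
    eapply Rle_trans; [apply Cmod_le_abs|]. unfold L.
    assert (Rabs (Re (w - (x, y))) <= b - a) by (simpl; unfold Re in *; apply Rabs_le; lra).
    assert (Rabs (Im (w - (x, y))) <= d - c) by (simpl; unfold Im in *; apply Rabs_le; lra). lra. }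
  split; eapply Rle_trans; try exact Hle. apply re_le_Cmod. apply im_le_Cmod. }
assert (B1 := RInt_dist_const (fun x => Re (f (x, c)) - Re (f (x, d))) a b (Im l * (d - c)) (2 * (eps * L))).
assert (B2 := RInt_dist_const (fun y => Im (f (b, y)) - Im (f (a, y))) c d (Im l * (b - a)) (2 * (eps * L))).
unfold rect_form.
set (I1 := RInt (fun x => Re (f (x, c)) - Re (f (x, d))) a b) in *.
set (I2 := RInt (fun y => Im (f (b, y)) - Im (f (a, y))) c d) in *.
assert (C1 : Rabs (I1 - (b - a) * (Im l * (d - c))) <= (b - a) * (2 * (eps * L))).
{ apply B1; [lra| |].
  - apply integrable_horizontal; [lra|]. intros t Ht; split; apply Hc; lra.
  - intros t Ht. destruct (HL (t, c)) as [K1 _]; simpl; try lra.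
    destruct (HL (t, d)) as [K2 _]; simpl; try lra.
    simpl in K1, K2. unfold Re, Im in *. apply Rabs_le_between in K1, K2. apply Rabs_le. lra. }
assert (C2 : Rabs (I2 - (d - c) * (Im l * (b - a))) <= (d - c) * (2 * (eps * L))).
{ apply B2; [lra| |].
  - apply integrable_vertical; [lra|]. intros t Ht; split; apply Hc; lra.
  - intros t Ht. destruct (HL (a, t)) as [_ K1]; simpl; try lra.
    destruct (HL (b, t)) as [_ K2]; simpl; try lra.
    simpl in K1, K2. unfold Re, Im in *. apply Rabs_le_between in K1, K2. apply Rabs_le. lra. }
clear B1 B2. unfold L in *. apply Rabs_le_between in C1, C2.
set (p := b - a) in *. set (q := d - c) in *.
assert (0 <= p /\ 0 <= q) as [P Q] by (unfold p, q; lra).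
assert (eps * ((p - q) ^ 2) >= 0) by (apply Rle_ge, Rmult_le_pos; [lra|apply pow2_ge_0]).
apply Rabs_le. split; nra.
Qed.

(** The bound 4 eps ((b - a)^2 + (d - c)^2) adds up exactly over the four quarters, so it passes from
    small rectangles to all of them. *)
Theorem goursat (f : C -> C) a b c d : a <= b -> c <= d ->
  (forall x y, a <= x <= b -> c <= y <= d -> cdiff f (x, y)) -> rect_form f a b c d = 0.
Proof.
intros Hab Hcd Hf.
assert (Hcont : cont_on f a b c d) by (intros x y Hx Hy; apply cdiff_cont, Hf; assumption).
set (D := (b - a) ^ 2 + (d - c) ^ 2).
assert (HD : 0 <= D) by (unfold D; nra).
assert (K : forall eps, 0 < eps -> Rabs (rect_form f a b c d) <= 4 * eps * D).
{ intros eps He.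
  apply (rectangle_bisection (fun a' b' c' d' => (a <= a' /\ b' <= b /\ c <= c' /\ d' <= d) ->
     Rabs (rect_form f a' b' c' d') <= 4 * eps * ((b' - a') ^ 2 + (d' - c') ^ 2)) a b c d); try lra.
  - intros a' b' c' d' H1 H2 Q1 Q2 Q3 Q4 Hin.
    assert (Hc' : cont_on f a' b' c' d') by (intros x y Hx Hy; apply Hcont; lra).
    rewrite (rect_form_split_x f a' ((a' + b') / 2)); try lra; [|assumption].
    rewrite (rect_form_split_y f a' ((a' + b') / 2) c' ((c' + d') / 2)); try lra; [|intros x y Hx Hy; apply Hcont; lra].
    rewrite (rect_form_split_y f ((a' + b') / 2) b' c' ((c' + d') / 2)); try lra; [|intros x y Hx Hy; apply Hcont; lra].
    specialize (Q1 ltac:(lra)). specialize (Q2 ltac:(lra)). specialize (Q3 ltac:(lra)). specialize (Q4 ltac:(lra)).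
    apply Rabs_le_between in Q1, Q2, Q3, Q4. apply Rabs_le.
    split; nra.
  - intros x y Hx Hy. destruct (Hf x y Hx Hy) as [l Hl]. rewrite is_cderive_eps in Hl.
    destruct (Hl eps He) as [delta [Hd HD']]. exists (delta / 2). split; [lra|].
    intros a' b' c' d' A B C' D' W1 W2 _. apply (rect_form_local f x y l); try lra.
    + intros s t Hs Ht; apply Hcont; lra.
    + intros w Hw1 Hw2. apply HD'. eapply Rle_lt_trans; [apply Cmod_le_abs|]. simpl. unfold Re, Im in *.
      assert (Rabs (fst w + - x) < delta / 2) by (apply Rabs_def1; lra).
      assert (Rabs (snd w + - y) < delta / 2) by (apply Rabs_def1; lra). lra. }
assert (H0 := Rabs_pos (rect_form f a b c d)).
destruct (Req_dec (rect_form f a b c d) 0) as [E|E]; [exact E|exfalso].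
apply Rabs_pos_lt in E. set (t := Rabs (rect_form f a b c d)) in *.
assert (He : 0 < t / (8 * (D + 1))) by (apply Rdiv_lt_0_compat; lra).
specialize (K _ He).
assert (4 * (t / (8 * (D + 1))) * D = t / 2 * (D / (D + 1))) by (field; lra).
assert (D / (D + 1) < 1) by (apply Rlt_div_l; lra). nra.
Qed.


(** * Mean values over circles and the maximum modulus principle *)

Definition circle (q : C) (r t : R) : C := (q + RtoC r * (cos t, sin t))%C.

Lemma Cmod_cos_sin t : Cmod (cos t, sin t) = 1.
Proof.
replace (cos t, sin t) with (cexp (0, t)).
- rewrite Cmod_cexp. simpl. apply exp_0.
- unfold cexp; simpl. rewrite exp_0, !Rmult_1_l. reflexivity.
Qed.
Lemma circle_dist q r t : 0 <= r -> Cmod (circle q r t - q) = r.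
Proof.
intros Hr. unfold circle. replace (q + r * (cos t, sin t) - q)%C with (r * (cos t, sin t))%C by ring.
rewrite Cmod_mult, Cmod_R, Cmod_cos_sin, Rabs_pos_eq; lra.
Qed.
Lemma Cmod_sub_pos (z q : C) : z <> q -> 0 < Cmod (z - q).
Proof.
intros H. apply Cmod_gt_0. intros E. apply H.
replace z with ((z - q) + q)%C by ring. rewrite E. ring.
Qed.
Lemma circle_neq_center q r t : 0 < r -> circle q r t <> q.
Proof.
intros Hr E. assert (K := circle_dist q r t (Rlt_le _ _ Hr)). rewrite E in K.
replace (q - q)%C with (RtoC 0) in K by ring. rewrite Cmod_0 in K. lra.
Qed.
Lemma continuous_circle g q r t : ccont g (circle q r t) -> continuous (fun s => Im (g (circle q r s))) t.
Proof.
intros H. apply (continuous_along_path g (circle q r) t H).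
- apply (continuous_ext (fun s => Re q + r * cos s)). { intros s. unfold circle. simpl. unfold Re. ring. }
  apply (ex_derive_continuous (K := R_AbsRing) (V := R_NormedModule)). auto_derive. auto.
- apply (continuous_ext (fun s => Im q + r * sin s)). { intros s. unfold circle. simpl. unfold Im. ring. }
  apply (ex_derive_continuous (K := R_AbsRing) (V := R_NormedModule)). auto_derive. auto.
Qed.

Definition cdiff_punctured (g : C -> C) (q : C) (r : R) :=
  forall z, z <> q -> Cmod (z - q) <= r -> cdiff g z.

Lemma ex_RInt_circle g q r : 0 < r -> cdiff_punctured g q r ->
  ex_RInt (fun t => Im (g (circle q r t))) 0 (2 * PI).
Proof.
intros Hr H. apply (ex_RInt_continuous (V := R_CompleteNormedModule)). intros t _.
apply continuous_circle, cdiff_cont, H.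
- apply circle_neq_center, Hr.
- rewrite circle_dist; lra.
Qed.

(** In the coordinate w with z = q + e^w the annulus becomes a rectangle of height 2 pi, and the
    integrals over its two horizontal sides cancel because g(q + e^w) has period 2 pi i. *)
Lemma circle_integral_radius g q rho r : 0 < rho <= r -> cdiff_punctured g q r ->
  RInt (fun t => Im (g (circle q rho t))) 0 (2 * PI) = RInt (fun t => Im (g (circle q r t))) 0 (2 * PI).
Proof.
intros [H0 Hle] Hg.
set (h := fun w => g (q + cexp w)%C).
assert (Hln : ln rho <= ln r) by (apply ln_le; assumption).
assert (HPI := PI_RGT_0).
assert (Hrect : rect_form h (ln rho) (ln r) 0 (2 * PI) = 0).
{ apply goursat; try lra. intros x y Hx Hy.
  assert (Hm : 0 < Cmod (cexp (x, y)) <= r).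
  { rewrite Cmod_cexp. simpl. split; [apply exp_pos|].
    destruct (Rle_lt_or_eq_dec x (ln r)) as [L|E]; [lra| |].
    - rewrite <- (exp_ln r) by lra. apply Rlt_le, exp_increasing, L.
    - rewrite E, exp_ln; lra. }
  apply (cdiff_comp g (fun w => q + cexp w)%C).
  - apply Hg.
    + intros E. apply (proj2 (Cmod_gt_0 _) (proj1 Hm)).
      replace (cexp (x, y)) with ((q + cexp (x, y)) - q)%C by ring. rewrite E. ring.
    + replace (q + cexp (x, y) - q)%C with (cexp (x, y)) by ring. apply Hm.
  - prove_cdiff. }
unfold rect_form in Hrect.
assert (E1 : forall s t, 0 < s -> h (ln s, t) = g (circle q s t)).
{ intros s t Hs. unfold h, circle. do 2 f_equal. unfold cexp; simpl. rewrite exp_ln by assumption.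
  apply injective_projections; simpl; ring. }
rewrite (RInt_ext _ (fun _ => 0)) in Hrect.
2: { intros x _. assert (E : h (x, 0) = h (x, 2 * PI)).
  { unfold h. do 2 f_equal. unfold cexp; simpl. rewrite cos_0, sin_0, cos_2PI, sin_2PI. reflexivity. }
  rewrite E. apply Rminus_diag_eq; reflexivity. }
rewrite RInt_const in Hrect. unfold scal in Hrect; simpl in Hrect. unfold mult in Hrect; simpl in Hrect.
rewrite (RInt_ext _ (fun t => minus (Im (g (circle q r t))) (Im (g (circle q rho t))))) in Hrect.
2: { intros t _. rewrite !E1 by lra. reflexivity. }
rewrite (RInt_minus (V := R_CompleteNormedModule)) in Hrect.
2: { apply ex_RInt_circle; [lra|assumption]. }
2: { apply ex_RInt_circle; [lra|]. intros z Hz Hz2. apply Hg; [assumption|lra]. }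
unfold minus, plus, opp in Hrect; simpl in Hrect. lra.
Qed.

(** Continuity at the centre suffices: let the inner radius tend to 0. *)
Lemma mean_value g q r : 0 < r -> ccont g q -> cdiff_punctured g q r ->
  RInt (fun t => Im (g (circle q r t))) 0 (2 * PI) = 2 * PI * Im (g q).
Proof.
intros Hr Hc Hg. assert (HPI := PI_RGT_0).
set (I := RInt (fun t => Im (g (circle q r t))) 0 (2 * PI)).
apply cond_eq. intros eps Heps.
set (e := eps / (4 * PI)).
assert (He : 0 < e) by (apply Rdiv_lt_0_compat; lra).
destruct (Hc e He) as [delta [Hd HD]].
set (rho := Rmin r (delta / 2)).
assert (Hrho : 0 < rho <= r) by (split; [apply Rmin_pos; lra|apply Rmin_l]).
assert (Hrho2 : rho <= delta / 2) by apply Rmin_r.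
unfold I. rewrite <- (circle_integral_radius g q rho r Hrho Hg).
assert (B : Rabs (RInt (fun t => Im (g (circle q rho t))) 0 (2 * PI) - (2 * PI - 0) * Im (g q)) <= (2 * PI - 0) * e).
{ apply RInt_dist_const; [lra| |].
  - apply ex_RInt_circle; [lra|]. intros z Hz Hz2. apply Hg; [assumption|lra].
  - intros t _. apply Rlt_le. eapply Rle_lt_trans; [apply (im_le_Cmod (g (circle q rho t) - g q))|].
    apply HD. rewrite circle_dist; lra. }
rewrite Rminus_0_r in B. eapply Rle_lt_trans; [exact B|]. unfold e.
replace (2 * PI * (eps / (4 * PI))) with (eps / 2) by (field; lra). lra.
Qed.

Lemma mean_value_le g q r k : 0 < r -> ccont g q -> cdiff_punctured g q r ->
  (forall t, Im (g (circle q r t)) <= k) -> Im (g q) <= k.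
Proof.
intros Hr Hc Hg H. assert (HPI := PI_RGT_0). assert (M := mean_value g q r Hr Hc Hg).
assert (L : RInt (fun t => Im (g (circle q r t))) 0 (2 * PI) <= RInt (fun _ => k) 0 (2 * PI)).
{ apply RInt_le; [lra|apply ex_RInt_circle; assumption|apply ex_RInt_const|]. intros t _. apply H. }
rewrite RInt_const in L. unfold scal in L; simpl in L. unfold mult in L; simpl in L. nra.
Qed.

Lemma mean_value_zero g q r : 0 < r -> ccont g q -> cdiff_punctured g q r ->
  (forall t, 0 <= Im (g (circle q r t))) -> Im (g q) = 0 ->
  forall t, 0 <= t < 2 * PI -> Im (g (circle q r t)) = 0.
Proof.
intros Hr Hc Hg H H0. assert (HPI := PI_RGT_0). assert (M := mean_value g q r Hr Hc Hg).
rewrite H0, Rmult_0_r in M.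
set (p := fun t => Im (g (circle q r t))) in *.
assert (Hex : forall a b, 0 <= a -> a <= b -> b <= 2 * PI -> ex_RInt p a b).
{ intros a b Ha Hab Hb.
  apply (ex_RInt_Chasles_1 (V := R_CompleteNormedModule)) with (2 * PI); [lra|].
  apply (ex_RInt_Chasles_2 (V := R_CompleteNormedModule)) with 0; [lra|].
  apply ex_RInt_circle; assumption. }
assert (Hp : forall t, continuous p t).
{ intros t. apply continuous_circle, cdiff_cont, Hg.
  - apply circle_neq_center, Hr.
  - rewrite circle_dist; lra. }
assert (Hin : forall t, 0 < t < 2 * PI -> p t = 0).
{ intros t0 Ht0.
destruct (Rle_lt_or_eq_dec 0 (p t0) (H t0)) as [Hlt|E]; [exfalso|symmetry; exact E].
assert (Hlt2 : 0 < p t0 / 2) by lra.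
destruct (proj1 (continuous_eps _ _) (Hp t0) _ Hlt2) as [delta [Hd HD]].
set (e := Rmin (delta / 2) (Rmin (t0 / 2) ((2 * PI - t0) / 2))).
assert (He : 0 < e) by (repeat apply Rmin_pos; lra).
assert (E1 : e <= delta / 2) by apply Rmin_l.
assert (E2 : e <= t0 / 2) by (eapply Rle_trans; [apply Rmin_r|apply Rmin_l]).
assert (E3 : e <= (2 * PI - t0) / 2) by (eapply Rle_trans; [apply Rmin_r|apply Rmin_r]).
rewrite <- (RInt_Chasles p 0 (t0 - e)) in M by (apply Hex; lra).
rewrite <- (RInt_Chasles p (t0 - e) (t0 + e)) in M by (apply Hex; lra).
unfold plus in M; simpl in M.
assert (P1 : 0 <= RInt p 0 (t0 - e)).
{ apply RInt_ge_0; [lra|apply Hex; lra|]. intros t _; apply H. }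
assert (P2 : 0 <= RInt p (t0 + e) (2 * PI)).
{ apply RInt_ge_0; [lra|apply Hex; lra|]. intros t _; apply H. }
assert (P3 : RInt (fun _ => p t0 / 2) (t0 - e) (t0 + e) <= RInt p (t0 - e) (t0 + e)).
{ apply RInt_le; [lra|apply ex_RInt_const|apply Hex; lra|]. intros t Ht.
  assert (Ht' : Rabs (t - t0) < delta) by (apply Rabs_def1; lra).
  specialize (HD t Ht'). apply Rabs_def2 in HD. lra. }
rewrite RInt_const in P3. unfold scal in P3; simpl in P3. unfold mult in P3; simpl in P3.
assert (0 < e * p t0) by nra. lra. }
intros t0 Ht0. destruct (Rle_lt_or_eq_dec 0 t0 (proj1 Ht0)) as [L|<-]; [apply Hin; lra|].
destruct (Rle_lt_or_eq_dec 0 (p 0) (H 0)) as [Hlt|E]; [exfalso|symmetry; exact E].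
destruct (proj1 (continuous_eps _ _) (Hp 0) _ Hlt) as [delta [Hd HD]].
set (e := Rmin (delta / 2) PI).
assert (He : 0 < e) by (apply Rmin_pos; lra).
assert (E1 : e <= delta / 2) by apply Rmin_l. assert (E2 : e <= PI) by apply Rmin_r.
assert (Hb : Rabs (e - 0) < delta) by (apply Rabs_def1; lra).
specialize (HD e Hb). apply Rabs_def2 in HD. rewrite (Hin e) in HD by lra. lra.
Qed.

Lemma ccont_Cmod f z : ccont f z -> forall eps, 0 < eps -> exists delta, 0 < delta /\
  forall w, Cmod (w - z) < delta -> Rabs (Cmod (f w) - Cmod (f z)) < eps.
Proof.
intros H eps He. destruct (H eps He) as [delta [Hd HD]]. exists delta; split; [assumption|].
intros w Hw. specialize (HD w Hw).
assert (T1 := Cmod_triangle (f w - f z) (f z)). assert (T2 := Cmod_triangle (f w) (- (f w - f z))).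
rewrite Cmod_opp in T2.
replace (f w - f z + f z)%C with (f w) in T1 by ring.
replace (f w + - (f w - f z))%C with (f z) in T2 by ring. apply Rabs_def1; lra.
Qed.

Lemma bounded_on_rectangle f a b c d : entire f -> exists B, 0 <= B /\
  forall z, a <= Re z <= b -> c <= Im z <= d -> Cmod (f z) <= B.
Proof.
intros Hf.
destruct (rectangle_max (fun z => Cmod (f z)) (Rmin a b) (Rmax a b) (Rmin c d) (Rmax c d)) as (x & y & _ & _ & H).
- apply Rminmax. - apply Rminmax.
- intros x y _ _. apply ccont_Cmod, cdiff_cont, Hf.
- exists (Cmod (f (x, y))). split; [apply Cmod_ge_0|]. intros [u v] Hu Hv; simpl in Hu, Hv.
  assert (K1 := Rmin_l a b). assert (K2 := Rmax_r a b). assert (K3 := Rmin_l c d). assert (K4 := Rmax_r c d).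
  apply H; lra.
Qed.

(** If |f| were larger inside than on the boundary, so would be |f|^2 + eps |z|^2 for small eps.  At
    an interior maximum q of that function, the holomorphic function Psi below has an imaginary part
    that contradicts the mean value property: its first term is a rotation of f^2 that makes
    the value at q equal to |f(q)|^4, and its second term is a multiple of the linear part of |z|^2 at q. *)
Theorem max_modulus f a b c d M : entire f ->
  (forall x, a <= x <= b -> Cmod (f (x, c)) <= M /\ Cmod (f (x, d)) <= M) ->
  (forall y, c <= y <= d -> Cmod (f (a, y)) <= M /\ Cmod (f (b, y)) <= M) ->
  forall z, a <= Re z <= b -> c <= Im z <= d -> Cmod (f z) <= M.
Proof.
intros Hf Hh Hv p Hp1 Hp2. apply Rnot_lt_le. intros Hlt.
assert (HM : 0 <= M) by (eapply Rle_trans; [apply Cmod_ge_0|apply (Hv (Im p) Hp2)]).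
destruct (bounded_on_rectangle (fun z => z) a b c d) as [B0 [HB0 HB1]]. { intros z; apply cdiff_id. }
set (B := B0 ^ 2).
assert (HB : forall z, a <= Re z <= b -> c <= Im z <= d -> Cmod z ^ 2 <= B).
{ intros z H1 H2. apply pow_incr. split; [apply Cmod_ge_0|]. apply HB1; assumption. }
assert (HBpos : 0 <= B) by (unfold B; apply pow2_ge_0).
set (m := Cmod (f p)) in *.
set (eps := (m ^ 2 - M ^ 2) / (2 * (B + 1))).
assert (Hgap : 0 < m ^ 2 - M ^ 2) by nra.
assert (He : 0 < eps) by (apply Rdiv_lt_0_compat; lra).
assert (HeB : eps * B < m ^ 2 - M ^ 2).
{ assert (E : eps * (2 * (B + 1)) = m ^ 2 - M ^ 2) by (unfold eps; field; lra). nra. }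
set (phi := fun z : C => Cmod (f z) ^ 2 + eps * Cmod z ^ 2).
destruct (rectangle_max phi a b c d) as (x & y & Hx & Hy & Hmax); try lra.
{ intros x y Hx Hy e0 He0.
  assert (He1 : 0 < e0 / (2 * eps)) by (apply Rdiv_lt_0_compat; lra).
  destruct (ccont_Cmod (fun z => f z * f z)%C (x, y)) with (eps := e0 / 2) as [d1 [Hd1 K1]]; [|lra|].
  { apply cdiff_cont. prove_cdiff; apply Hf. }
  destruct (ccont_Cmod (fun z => z * z)%C (x, y)) with (eps := e0 / (2 * eps)) as [d2 [Hd2 K2]]; [|assumption|].
  { apply cdiff_cont. prove_cdiff. }
  exists (Rmin d1 d2). split; [apply Rmin_pos; assumption|]. intros w Hw.
  specialize (K1 w (Rlt_le_trans _ _ _ Hw (Rmin_l _ _))). specialize (K2 w (Rlt_le_trans _ _ _ Hw (Rmin_r _ _))).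
  rewrite !Cmod_mult in K1, K2. apply (Rmult_lt_compat_l eps) in K2; [|assumption].
  replace (eps * (e0 / (2 * eps))) with (e0 / 2) in K2 by (field; lra).
  rewrite <- (Rabs_pos_eq eps) in K2 at 1 by lra. rewrite <- Rabs_mult in K2.
  apply Rabs_def2 in K1, K2. unfold phi. apply Rabs_def1; lra. }
set (q := (x, y)) in *.
assert (Hq : m ^ 2 <= phi q).
{ destruct p as [p1 p2]. simpl in Hp1, Hp2. specialize (Hmax p1 p2 Hp1 Hp2). unfold phi in Hmax at 1.
  fold m in Hmax. assert (0 <= Cmod (p1, p2) ^ 2) by apply pow2_ge_0. nra. }
assert (HqB : Cmod q ^ 2 <= B) by (apply HB; simpl; assumption).
set (N := Cmod (f q) ^ 2).
assert (HN : M ^ 2 < N).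
{ unfold phi in Hq. fold N in Hq. nra. }
assert (HfqM : M < Cmod (f q)).
{ apply Rnot_le_lt. intros L. unfold N in HN. assert (0 <= Cmod (f q)) by apply Cmod_ge_0. nra. }
assert (Ix : a < x < b).
{ split; apply Rnot_le_lt; intros L.
  - assert (x = a) by lra. destruct (Hv y Hy) as [K _]. unfold q in HfqM. subst x. lra.
  - assert (x = b) by lra. destruct (Hv y Hy) as [_ K]. unfold q in HfqM. subst x. lra. }
assert (Iy : c < y < d).
{ split; apply Rnot_le_lt; intros L.
  - assert (y = c) by lra. destruct (Hh x Hx) as [K _]. unfold q in HfqM. subst y. lra.
  - assert (y = d) by lra. destruct (Hh x Hx) as [_ K]. unfold q in HfqM. subst y. lra. }
set (r := Rmin (Rmin (x - a) (b - x)) (Rmin (y - c) (d - y))).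
assert (Hr : 0 < r) by (repeat apply Rmin_pos; lra).
assert (R1 : r <= x - a) by (eapply Rle_trans; [apply Rmin_l|apply Rmin_l]).
assert (R2 : r <= b - x) by (eapply Rle_trans; [apply Rmin_l|apply Rmin_r]).
assert (R3 : r <= y - c) by (eapply Rle_trans; [apply Rmin_r|apply Rmin_l]).
assert (R4 : r <= d - y) by (eapply Rle_trans; [apply Rmin_r|apply Rmin_r]).
set (Psi := fun w => (Ci * (Cconj (f q * f q) * (f w * f w)) + Ci * (RtoC (2 * eps * N) * (Cconj q * w)))%C).
assert (HPsi : forall w, cdiff Psi w) by (intros w; unfold Psi; prove_cdiff; apply Hf).
assert (Em : forall w, Im (Psi w) = Re (Cconj (f q * f q) * (f w * f w))%C + 2 * eps * N * Re (Cconj q * w)%C).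
{ intros w. unfold Psi. unfold Ci, Re, Im. simpl. ring. }
assert (Eq : Im (Psi q) = N ^ 2 + 2 * eps * N * Cmod q ^ 2).
{ rewrite Em. f_equal.
  - rewrite Cmult_conj. unfold N. rewrite Cmod2_alt. unfold Re, Im. simpl. ring.
  - rewrite Cmod2_alt. unfold Re, Im. simpl. ring. }
assert (Hle : Im (Psi q) <= N * (N + 2 * eps * Cmod q ^ 2 - eps * r ^ 2)).
{ apply (mean_value_le Psi q r); [assumption|apply cdiff_cont, HPsi|intros z _ _; apply HPsi|].
  intros t. set (w := circle q r t).
  assert (Hw : phi w <= phi q).
  { assert (Hd : Cmod (w - q) = r) by (apply circle_dist; lra). clearbody w.
    assert (W1 := re_le_Cmod (w - q)). assert (W2 := im_le_Cmod (w - q)). rewrite Hd in W1, W2.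
    unfold q in W1, W2. simpl in W1, W2. destruct w as [w1 w2]. simpl in W1, W2.
    apply Rabs_le_between in W1, W2. apply Hmax; lra. }
  assert (Ew : r ^ 2 = Cmod w ^ 2 - 2 * Re (Cconj q * w)%C + Cmod q ^ 2).
  { rewrite <- (circle_dist q r t) by lra. fold w. rewrite !Cmod2_alt. clearbody w q. destruct w, q. simpl. ring. }
  rewrite Em.
  assert (Hre : Re (Cconj (f q * f q) * (f w * f w))%C <= N * Cmod (f w) ^ 2).
  { eapply Rle_trans; [apply Rle_abs|]. eapply Rle_trans; [apply re_le_Cmod|].
    rewrite !Cmod_mult, Cmod_conj, Cmod_mult. unfold N. lra. }
  unfold phi in Hw. fold N in Hw.
  assert (0 <= N) by (unfold N; apply pow2_ge_0).
  assert (N * Cmod (f w) ^ 2 <= N * (N + eps * Cmod q ^ 2 - eps * Cmod w ^ 2)) by (apply Rmult_le_compat_l; lra).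
  nra. }
rewrite Eq in Hle.
assert (0 < N) by (assert (0 <= M ^ 2) by apply pow2_ge_0; lra).
assert (0 < eps * r ^ 2) by (apply Rmult_lt_0_compat; [assumption|apply pow_lt; assumption]). nra.
Qed.

(** The quotients f / (z - q)^k are entire, so that on the square of half-width 2 |z - q| the maximum
    principle gives |f(z)| <= B 2^(-k) for every k. *)
Theorem vanishing_near_point f q r : entire f -> 0 < r ->
  (forall z, Cmod (z - q) < r -> f z = 0) -> forall z, f z = 0.
Proof.
intros Hf Hr H0 z.
destruct (Req_dec (Cmod (z - q)) 0) as [E|E].
{ apply H0. lra. }
assert (Hz : 0 < Cmod (z - q)) by (generalize (Cmod_ge_0 (z - q)); lra).
set (s := Cmod (z - q)) in *. set (R0 := 2 * s).
destruct (bounded_on_rectangle f (Re q - R0) (Re q + R0) (Im q - R0) (Im q + R0) Hf) as [B [HB0 HB]].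
apply Cmod_eq_0. apply Rle_antisym; [|apply Cmod_ge_0]. apply Rnot_lt_le. intros Hlt.
set (g := fun k w => if Rlt_dec (Cmod (w - q)) r then RtoC 0 else (f w / (w - q) ^ k)%C).
assert (Hne : forall w, r <= Cmod (w - q) -> (w - q)%C <> 0).
{ intros w Hw. apply Cmod_gt_0. lra. }
assert (Hg : forall k, entire (g k)).
{ intros k w. destruct (Rle_lt_dec r (Cmod (w - q))) as [L|L].
  - apply (cdiff_ext_loc (fun w => f w / (w - q) ^ k)%C _ w r Hr).
    + intros w' Hw'. unfold g. destruct (Rlt_dec (Cmod (w' - q)) r) as [K|K]; [|reflexivity].
      rewrite (H0 w' K). apply Cmult_0_l.
    + apply cdiff_div; [apply Hf|prove_cdiff|]. apply Cpow_nz, Hne, L.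
  - apply (cdiff_ext_loc (fun _ => RtoC 0) _ w (r - Cmod (w - q))); [lra| |apply cdiff_const].
    intros w' Hw'. unfold g. destruct (Rlt_dec (Cmod (w' - q)) r) as [K|K]; [reflexivity|].
    exfalso. apply K. replace (w' - q)%C with ((w' - w) + (w - q))%C by ring.
    eapply Rle_lt_trans; [apply Cmod_triangle|]. lra. }
assert (Hbd : forall k w, R0 <= Cmod (w - q) -> Cmod (f w) <= B -> Cmod (g k w) <= B / R0 ^ k).
{ intros k w Hw HfB. unfold g.
  assert (0 < R0 ^ k) by (apply pow_lt; unfold R0; lra).
  destruct (Rlt_dec (Cmod (w - q)) r) as [K|K].
  - rewrite Cmod_0. apply Rle_div_r; lra.
  - rewrite Cmod_div by (apply Cpow_nz, Hne; lra). rewrite Cmod_pow.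
    apply Rmult_le_compat; [apply Cmod_ge_0| |assumption|].
    + apply Rlt_le, Rinv_0_lt_compat, pow_lt. lra.
    + apply Rinv_le_contravar; [assumption|]. apply pow_incr. unfold R0 in *; lra. }
assert (Hk : forall k, Cmod (f z) <= B / 2 ^ k).
{ intros k.
  assert (Hin : Rabs (Re (z - q)) <= s /\ Rabs (Im (z - q)) <= s) by (split; [apply re_le_Cmod|apply im_le_Cmod]).
  destruct Hin as [I1 I2]. simpl in I1, I2. fold (Re z) (Re q) (Im z) (Im q) in I1, I2.
  apply Rabs_le_between in I1, I2.
  assert (Hm : Cmod (g k z) <= B / R0 ^ k).
  { apply (max_modulus (g k) (Re q - R0) (Re q + R0) (Im q - R0) (Im q + R0)); try (unfold R0; lra).
    - apply Hg.
    - intros x Hx. split; apply Hbd; try (apply HB; simpl; unfold R0 in *; lra);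
      (eapply Rle_trans; [|apply im_le_Cmod]; simpl; fold (Im q); unfold Rabs; destruct Rcase_abs; unfold R0 in *; lra).
    - intros x Hx. split; apply Hbd; try (apply HB; simpl; unfold R0 in *; lra);
      (eapply Rle_trans; [|apply re_le_Cmod]; simpl; fold (Re q); unfold Rabs; destruct Rcase_abs; unfold R0 in *; lra). }
  unfold g in Hm. destruct (Rlt_dec (Cmod (z - q)) r) as [K|K].
  - rewrite (H0 z K), Cmod_0 in Hlt. lra.
  - fold s in K. rewrite Cmod_div in Hm by (apply Cpow_nz, Hne; fold s; lra). rewrite Cmod_pow in Hm. fold s in Hm.
    assert (P : 0 < s ^ k) by (apply pow_lt; assumption).
    assert (P2 : 0 < 2 ^ k) by (apply pow_lt; lra).
    apply (proj1 (Rle_div_l _ _ _ P)) in Hm. unfold R0 in Hm. rewrite Rpow_mult_distr in Hm.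
    replace (B / (2 ^ k * s ^ k) * s ^ k) with (B / 2 ^ k) in Hm by (field; lra). exact Hm. }
destruct (pow2_small B (Cmod (f z)) Hlt) as [n Hn]. specialize (Hk n). lra.
Qed.


(** * Theorems of Phragmen and Lindelof *)

Lemma le_limit_right (phi : R -> R) (a e0 : R) : 0 < e0 -> ex_derive phi 0 ->
  (forall e, 0 < e < e0 -> a <= phi e) -> a <= phi 0.
Proof.
intros He0 Hphi H. apply Rnot_lt_le. intros Hlt.
assert (Hc : continuous phi 0) by (apply (ex_derive_continuous (K := R_AbsRing) (V := R_NormedModule)); exact Hphi).
destruct (proj1 (continuous_eps _ _) Hc (a - phi 0)) as [d [Hd HD]]; [lra|].
set (e := Rmin (d / 2) (e0 / 2)).
assert (0 < e) by (apply Rmin_pos; lra).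
assert (e <= d / 2) by apply Rmin_l. assert (e <= e0 / 2) by apply Rmin_r.
assert (Hb : Rabs (e - 0) < d) by (apply Rabs_def1; lra).
specialize (HD e Hb). apply Rabs_def2 in HD. specialize (H e ltac:(lra)). lra.
Qed.

Lemma exp_neg_small K kappa : 0 < kappa -> exists R0, 0 < R0 /\ forall x, R0 <= x -> K * exp (- x) <= kappa.
Proof.
intros Hk. exists (Rabs K / kappa + 1).
assert (H0 : 0 <= Rabs K / kappa) by (apply Rdiv_le_0_compat; [apply Rabs_pos|assumption]).
split; [lra|]. intros x Hx.
assert (Hx0 : 0 < x) by lra.
assert (He := exp_ineq1 x ltac:(lra)).
rewrite exp_Ropp. apply Rle_div_l; [apply exp_pos|].
assert (HK := Rle_abs K).
assert (Rabs K <= kappa * x).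
{ assert (E : Rabs K / kappa * kappa = Rabs K) by (field; lra). nra. }
nra.
Qed.

Lemma exp_le x y : x <= y -> exp x <= exp y.
Proof. intros [H|H]; [apply Rlt_le, exp_increasing, H|rewrite H; apply Rle_refl]. Qed.

Lemma le_exp_transfer h k t : h * exp (- t) <= k -> h <= k * exp t.
Proof.
intros H. apply (Rmult_le_compat_r (exp t)) in H; [|apply Rlt_le, exp_pos].
rewrite Rmult_assoc, <- exp_plus, Rplus_opp_l, exp_0, Rmult_1_r in H. exact H.
Qed.

Lemma gauss_small K b eta kappa : 0 < eta -> 0 < kappa ->
  exists R0, 0 < R0 /\ forall x, R0 <= x -> K * exp (b * x - eta * x ^ 2) <= kappa.
Proof.
intros He Hk. destruct (exp_neg_small (Rabs K) kappa Hk) as [R0 [H0 H]].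
exists (Rmax R0 ((Rabs b + 1) / eta)). split.
{ eapply Rlt_le_trans; [exact H0|apply Rmax_l]. }
intros x Hx. assert (X1 := Rle_trans _ _ _ (Rmax_l _ _) Hx). assert (X2 := Rle_trans _ _ _ (Rmax_r _ _) Hx).
eapply Rle_trans; [|apply (H x X1)].
eapply Rle_trans. { apply Rmult_le_compat_r; [apply Rlt_le, exp_pos|apply Rle_abs]. }
apply Rmult_le_compat_l; [apply Rabs_pos|]. apply exp_le.
apply Rle_div_l in X2; [|assumption]. assert (Hb := Rle_abs b). nra.
Qed.

Lemma exp_le_1 x : x <= 0 -> exp x <= 1.
Proof. intros H. rewrite <- exp_0. apply exp_le, H. Qed.

Lemma bound_constant_nonneg (h : C) K t : Cmod h <= K * exp t -> 0 <= K.
Proof. intros H. assert (B := Cmod_ge_0 h). assert (E := exp_pos t). nra. Qed.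

(** In a horizontal strip (a half strip when [half] is true) the factor e^(- eta z^2) beats any
    exponential growth, and it tends to 1 with eta. *)
Lemma strip_phragmen_lindelof (half : bool) H K b M c d : entire H -> 0 <= M ->
  0 <= b -> c <= d ->
  (forall z, c <= Im z <= d -> Cmod (H z) <= K * exp (b * Cmod z)) ->
  (forall x, (half = true -> 0 <= x) -> Cmod (H (x, c)) <= M /\ Cmod (H (x, d)) <= M) ->
  (half = true -> forall y, c <= y <= d -> Cmod (H (0, y)) <= M) ->
  forall z, (half = true -> 0 <= Re z) -> c <= Im z <= d -> Cmod (H z) <= M.
Proof.
intros HH HM Hb Hcd Hgrow Hhor Hver [x y] Hx Hy. simpl in Hx, Hy.
set (Y := Rabs c + Rabs d).
assert (HY : forall t, c <= t <= d -> Rabs t <= Y).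
{ intros t Ht. unfold Y, Rabs. repeat destruct Rcase_abs; lra. }
assert (HK : 0 <= K) by (apply (bound_constant_nonneg _ _ _ (Hgrow (0, c) ltac:(simpl; lra)))).
assert (Lim : forall eta, 0 < eta < 1 -> Cmod (H (x, y)) <= (M * exp (eta * Y ^ 2) + eta) * exp (eta * x ^ 2)).
{ intros eta [Heta _].
  set (G := fun z => (H z * cexp (- (RtoC eta * (z * z))))%C).
  assert (HG : entire G) by (intros z; unfold G; prove_cdiff; apply HH).
  assert (MG : forall u v, Cmod (G (u, v)) = Cmod (H (u, v)) * exp (- (eta * (u ^ 2 - v ^ 2)))).
  { intros u v. unfold G. rewrite Cmod_mult, Cmod_cexp. do 2 f_equal. simpl. ring. }
  assert (Hw : forall v, c <= v <= d -> v ^ 2 <= Y ^ 2).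
  { intros v Hv. rewrite <- (pow2_abs v). apply pow_incr. split; [apply Rabs_pos|apply HY, Hv]. }
  assert (Hside : forall u v, c <= v <= d -> Cmod (H (u, v)) <= M -> Cmod (G (u, v)) <= M * exp (eta * Y ^ 2) + eta).
  { intros u v Hv HMv. rewrite MG. specialize (Hw v Hv).
    assert (exp (- (eta * (u ^ 2 - v ^ 2))) <= exp (eta * Y ^ 2)) by (apply exp_le; nra).
    assert (0 < exp (- (eta * (u ^ 2 - v ^ 2)))) by apply exp_pos.
    assert (0 <= Cmod (H (u, v))) by apply Cmod_ge_0. nra. }
  destruct (gauss_small (K * exp (b * Y + eta * Y ^ 2)) b eta eta Heta Heta) as [R0 [HR0 HR]].
  set (R1 := Rmax R0 (Rabs x)).
  assert (R1a : R0 <= R1) by apply Rmax_l. assert (R1b : Rabs x <= R1) by apply Rmax_r.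
  assert (Hfar : forall u v, Rabs u = R1 -> c <= v <= d -> Cmod (G (u, v)) <= M * exp (eta * Y ^ 2) + eta).
  { intros u v Hu Hv. assert (0 <= M * exp (eta * Y ^ 2)) by (apply Rmult_le_pos; [assumption|apply Rlt_le, exp_pos]).
    enough (Cmod (G (u, v)) <= eta) by lra.
    eapply Rle_trans; [|apply (HR R1 R1a)]. rewrite MG.
    eapply Rle_trans. { apply Rmult_le_compat_r; [apply Rlt_le, exp_pos|apply Hgrow; simpl; assumption]. }
    rewrite !Rmult_assoc. apply Rmult_le_compat_l; [assumption|]. rewrite <- !exp_plus. apply exp_le.
    assert (Cmod (u, v) <= R1 + Y).
    { eapply Rle_trans; [apply Cmod_le_abs|]. simpl. rewrite Hu. specialize (HY v Hv). lra. }
    specialize (Hw v Hv). rewrite <- Hu, pow2_abs, Hu. nra. }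
  assert (Hbox : Cmod (G (x, y)) <= M * exp (eta * Y ^ 2) + eta).
  { apply (max_modulus G (if half then 0 else - R1) R1 c d).
    - exact HG.
    - intros u Hu. assert (Hu' : half = true -> 0 <= u) by (intros E; rewrite E in Hu; lra).
      split; apply Hside; try lra; apply Hhor, Hu'.
    - intros v Hv. split.
      + destruct half. * apply Hside; [assumption|]. apply Hver; auto.
        * apply Hfar; [|assumption]. rewrite Rabs_Ropp. apply Rabs_pos_eq; lra.
      + apply Hfar; [|assumption]. apply Rabs_pos_eq; lra.
    - simpl. apply Rabs_le_between in R1b. destruct half; [specialize (Hx eq_refl)|]; lra.
    - exact Hy. }
  rewrite MG in Hbox.
  apply le_exp_transfer in Hbox. eapply Rle_trans; [exact Hbox|]. apply Rmult_le_compat_l.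
  - assert (0 < exp (eta * Y ^ 2)) by apply exp_pos. nra.
  - apply exp_le. assert (0 <= y ^ 2) by apply pow2_ge_0. nra. }
assert (L := le_limit_right (fun eta => (M * exp (eta * Y ^ 2) + eta) * exp (eta * x ^ 2)) (Cmod (H (x, y))) 1 Rlt_0_1).
simpl in L. rewrite !Rmult_0_l, exp_0 in L.
eapply Rle_trans; [apply L|]; [auto_derive; auto|exact Lim|lra].
Qed.

(** The factor e^(- eta (1 - i) z) has modulus e^(- eta (x + y)) in the quadrant. *)
Lemma quadrant_bounded H K M : entire H -> 0 <= M ->
  (forall z, 0 <= Re z -> 0 <= Im z -> Cmod (H z) <= K) ->
  (forall t, 0 <= t -> Cmod (H (t, 0)) <= M /\ Cmod (H (0, t)) <= M) ->
  forall z, 0 <= Re z -> 0 <= Im z -> Cmod (H z) <= M.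
Proof.
intros HH HM HK Hax [x y] Hx Hy. simpl in Hx, Hy.
assert (Lim : forall eta, 0 < eta < 1 -> Cmod (H (x, y)) <= (M + eta) * exp (eta * (x + y))).
{ intros eta [Heta _].
  set (G := fun z => (H z * cexp (- (RtoC eta * ((1, -1) * z))))%C).
  assert (HG : entire G) by (intros z; unfold G; prove_cdiff; apply HH).
  assert (MG : forall u v, Cmod (G (u, v)) = Cmod (H (u, v)) * exp (- (eta * (u + v)))).
  { intros u v. unfold G. rewrite Cmod_mult, Cmod_cexp. do 2 f_equal. simpl. ring. }
  destruct (exp_neg_small K eta Heta) as [R0 [HR0 HR]].
  set (R1 := Rmax (R0 / eta) (x + y)).
  assert (R1a : R0 / eta <= R1) by apply Rmax_l. assert (R1b : x + y <= R1) by apply Rmax_r.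
  apply Rle_div_l in R1a; [|assumption].
  assert (HK0 : 0 <= K) by (eapply Rle_trans; [apply Cmod_ge_0|apply (HK (0,0)); simpl; lra]).
  assert (Hfar : forall u v, 0 <= u -> 0 <= v -> R1 <= u + v -> Cmod (G (u, v)) <= M + eta).
  { intros u v Hu Hv Huv. rewrite MG. specialize (HR (eta * (u + v)) ltac:(nra)).
    specialize (HK (u, v) Hu Hv). assert (0 < exp (- (eta * (u + v)))) by apply exp_pos. nra. }
  assert (Hnear : forall u v, 0 <= u -> 0 <= v -> Cmod (H (u, v)) <= M -> Cmod (G (u, v)) <= M + eta).
  { intros u v Hu Hv Huv. rewrite MG.
    assert (exp (- (eta * (u + v))) <= 1) by (apply exp_le_1; nra).
    assert (0 < exp (- (eta * (u + v)))) by apply exp_pos. assert (0 <= Cmod (H (u, v))) by apply Cmod_ge_0. nra. }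
  assert (Hbox : Cmod (G (x, y)) <= M + eta).
  { apply (max_modulus G 0 R1 0 R1); simpl; try lra.
    - exact HG.
    - intros u Hu. split; [apply Hnear; try lra; apply Hax; lra|apply Hfar; lra].
    - intros v Hv. split; [apply Hnear; try lra; apply Hax; lra|apply Hfar; lra]. }
  rewrite MG in Hbox. apply le_exp_transfer, Hbox. }
assert (L := le_limit_right (fun eta => (M + eta) * exp (eta * (x + y))) (Cmod (H (x, y))) 1 Rlt_0_1).
simpl in L. rewrite !Rmult_0_l, exp_0 in L.
eapply Rle_trans; [apply L|]; [auto_derive; auto|exact Lim|lra].
Qed.

Lemma rot_mult x y : (Ci * (x, y))%C = (- y, x).
Proof. unfold Ci. apply injective_projections; simpl; ring. Qed.
Lemma Cmod_rot x y : Cmod (- y, x) = Cmod (x, y).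
Proof. rewrite <- rot_mult, Cmod_mult, Cmod_Ci. ring. Qed.

(** The order of growth 1 is below the critical order 2 of a quadrant.  The factor e^(i delta z^2)
    has modulus e^(- 2 delta x y): it leaves the values on the two axes unchanged and makes the
    function bounded where both x and y are at least w = b / (2 delta).  The two remaining half strips
    are covered by [strip_phragmen_lindelof], and [quadrant_bounded] then replaces the bound
    by the one on the axes, which does not depend on delta. *)
Lemma quadrant_phragmen_lindelof G K b M : entire G -> 0 <= M -> 0 < b ->
  (forall z, Cmod (G z) <= K * exp (b * Cmod z)) ->
  (forall t, 0 <= t -> Cmod (G (t, 0)) <= M /\ Cmod (G (0, t)) <= M) ->
  forall z, 0 <= Re z -> 0 <= Im z -> Cmod (G z) <= M.
Proof.
intros HG HM Hb Hgrow Hax [x y] Hx Hy. simpl in Hx, Hy.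
assert (HK : 0 <= K) by (apply (bound_constant_nonneg _ _ _ (Hgrow (0, 0)))).
assert (Lim : forall delta, 0 < delta < 1 -> Cmod (G (x, y)) <= M * exp (2 * delta * (x * y))).
{ intros delta [Hdelta _].
  set (H := fun z => (G z * cexp (Ci * (RtoC delta * (z * z))))%C).
  assert (HH : entire H) by (intros z; unfold H; prove_cdiff; apply HG).
  assert (MH : forall u v, Cmod (H (u, v)) = Cmod (G (u, v)) * exp (- (2 * delta * (u * v)))).
  { intros u v. unfold H. rewrite Cmod_mult, Cmod_cexp. do 2 f_equal. simpl. ring. }
  set (w := b / (2 * delta)).
  assert (Hw : 2 * delta * w = b) by (unfold w; field; lra).
  assert (Hw0 : 0 < w) by (apply Rdiv_lt_0_compat; lra).
  set (M1 := M + K * exp (b * w)).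
  assert (HM1 : M <= M1) by (unfold M1; assert (0 < exp (b * w)) by apply exp_pos; nra).
  assert (Haxis : forall t, 0 <= t -> Cmod (H (t, 0)) <= M /\ Cmod (H (0, t)) <= M).
  { intros t Ht. rewrite !MH, Rmult_0_r, Rmult_0_l, Rmult_0_r, Ropp_0, exp_0, !Rmult_1_r. apply Hax, Ht. }
  assert (Hout : forall u v, 0 <= u -> 0 <= v -> 0 <= (u - w) * (v - w) -> Cmod (H (u, v)) <= M1).
  { intros u v Hu Hv Huv. rewrite MH.
    eapply Rle_trans. { apply Rmult_le_compat_r; [apply Rlt_le, exp_pos|apply Hgrow]. }
    rewrite Rmult_assoc, <- exp_plus. unfold M1.
    assert (K * exp (b * Cmod (u, v) + - (2 * delta * (u * v))) <= K * exp (b * w)); [|lra].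
    apply Rmult_le_compat_l; [assumption|]. apply exp_le.
    assert (Hc : Cmod (u, v) <= u + v).
    { eapply Rle_trans; [apply Cmod_le_abs|]. simpl. rewrite !Rabs_pos_eq; lra. }
    assert (b * Cmod (u, v) <= b * (u + v)) by (apply Rmult_le_compat_l; lra).
    assert (0 <= delta * ((u - w) * (v - w))) by (apply Rmult_le_pos; lra). rewrite <- Hw in *. nra. }
  assert (Hgr : forall u v, Rabs u <= w \/ Rabs v <= w ->
     Cmod (H (u, v)) <= K * exp ((b + 2 * delta * w) * Cmod (u, v))).
  { intros u v Huv. rewrite MH.
    eapply Rle_trans. { apply Rmult_le_compat_r; [apply Rlt_le, exp_pos|apply Hgrow]. }
    rewrite Rmult_assoc, <- exp_plus. apply Rmult_le_compat_l; [assumption|]. apply exp_le.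
    assert (- (u * v) <= w * Cmod (u, v)).
    { assert (A1 := re_le_Cmod (u, v)). assert (A2 := im_le_Cmod (u, v)). simpl in A1, A2.
      assert (A3 := Rabs_pos u). assert (A4 := Rabs_pos v).
      eapply Rle_trans; [apply Rle_abs|]. rewrite Rabs_Ropp, Rabs_mult. destruct Huv; nra. }
    nra. }
  assert (Hhor : forall u v, 0 <= u -> 0 <= v <= w -> Cmod (H (u, v)) <= M1).
  { intros u v Hu Hv.
    apply (strip_phragmen_lindelof true H K (b + 2 * delta * w) M1 0 w); simpl; try nra.
    - exact HH.
    - intros [p q] Hq. simpl in Hq. apply Hgr. right. rewrite Rabs_pos_eq; lra.
    - intros t Ht. specialize (Ht eq_refl). split; [eapply Rle_trans; [apply Haxis; exact Ht|assumption]|].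
      apply Hout; [lra|lra|]. rewrite Rminus_diag, ?Rmult_0_r, ?Rmult_0_l. apply Rle_refl.
    - intros _ t Ht. eapply Rle_trans; [apply Haxis; lra|assumption]. }
  assert (Hvert : forall u v, 0 <= v -> 0 <= u <= w -> Cmod (H (u, v)) <= M1).
  { intros u v Hv Hu.
    replace (u, v) with (Ci * (v, (- u)%R))%C by (rewrite rot_mult, Ropp_involutive; reflexivity).
    apply (strip_phragmen_lindelof true (fun z => H (Ci * z)%C) K (b + 2 * delta * w) M1 (- w) 0); simpl; try nra.
    - intros z. apply (cdiff_comp H (fun z => Ci * z)%C); [apply HH|prove_cdiff].
    - intros [p q] Hq. simpl in Hq. rewrite rot_mult. rewrite <- (Cmod_rot p q). apply Hgr. left. rewrite Rabs_pos_eq; lra.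
    - intros t Ht. specialize (Ht eq_refl). rewrite !rot_mult, Ropp_involutive, Ropp_0. split.
      + apply Hout; [lra|lra|]. rewrite Rminus_diag, ?Rmult_0_r, ?Rmult_0_l. apply Rle_refl.
      + eapply Rle_trans; [apply Haxis; exact Ht|assumption].
    - intros _ t Ht. rewrite rot_mult. eapply Rle_trans; [apply Haxis; lra|assumption]. }
  assert (Hfin : Cmod (H (x, y)) <= M).
  { apply (quadrant_bounded H M1 M); simpl; try assumption.
    intros [u v] Hu Hv. simpl in Hu, Hv.
    destruct (Rle_lt_dec v w) as [L1|L1]; [apply Hhor; lra|].
    destruct (Rle_lt_dec u w) as [L2|L2]; [apply Hvert; lra|].
    apply Hout; try lra. apply Rmult_le_pos; lra. }
  rewrite MH in Hfin. apply le_exp_transfer, Hfin. }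
assert (L := le_limit_right (fun delta => M * exp (2 * delta * (x * y))) (Cmod (G (x, y))) 1 Rlt_0_1).
simpl in L. rewrite Rmult_0_r, !Rmult_0_l, exp_0 in L.
eapply Rle_trans; [apply L|]; [auto_derive; auto|exact Lim|lra].
Qed.

Definition growth_le (b : R) (f : C -> C) := exists K, forall z, Cmod (f z) <= K * exp (b * Cmod z).

(** The function G = F e^(i s' z), with s' slightly above s, is bounded on the imaginary axis, hence on
    both quadrants, by some M0 that may exceed M.  To bring M0 down to M, apply the strip lemma on
    0 <= y <= 1/t to G e^(i k z) with k = t M0 / M, whose modulus on the upper side is at most
    M0 e^(- M0 / M) <= M. *)
Lemma upper_half_plane_bound F s M : entire F -> 0 <= s -> 0 < M ->
  (forall eps, 0 < eps -> growth_le (s + eps) F) -> (forall t, Cmod (F (t, 0)) <= M) ->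
  forall x y, 0 <= y -> Cmod (F (x, y)) <= M * exp (s * y).
Proof.
intros HF Hs HM Hgrow HR x y Hy.
assert (Lim : forall eps, 0 < eps < 1 -> Cmod (F (x, y)) <= M * exp ((s + eps) * y)).
{ intros eps [Heps _]. destruct (Hgrow eps Heps) as [K HK]. set (s' := s + eps) in *.
  assert (Hs' : 0 < s') by (unfold s'; lra).
  set (G := fun z => (F z * cexp (Ci * (RtoC s' * z)))%C).
  assert (HG : entire G) by (intros z; unfold G; prove_cdiff; apply HF).
  assert (MG : forall u v, Cmod (G (u, v)) = Cmod (F (u, v)) * exp (- (s' * v))).
  { intros u v. unfold G. rewrite Cmod_mult, Cmod_cexp. do 2 f_equal. simpl. ring. }
  assert (HK0 : 0 <= K) by (apply (bound_constant_nonneg _ _ _ (HK (0, 0)))).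
  set (M0 := M + K).
  assert (Hreal : forall t, Cmod (G (t, 0)) <= M0).
  { intros t. rewrite MG, Rmult_0_r, Ropp_0, exp_0, Rmult_1_r. specialize (HR t). unfold M0; lra. }
  assert (Himag : forall t, 0 <= t -> Cmod (G (0, t)) <= M0).
  { intros t Ht. rewrite MG. eapply Rle_trans. { apply Rmult_le_compat_r; [apply Rlt_le, exp_pos|apply HK]. }
    replace (Cmod (0, t)) with t.
    - rewrite Rmult_assoc, <- exp_plus. replace (s' * t + - (s' * t)) with 0 by ring. rewrite exp_0. unfold M0. lra.
    - replace (0, t) with (Ci * RtoC t)%C. rewrite Cmod_mult, Cmod_Ci, Cmod_R, Rabs_pos_eq; lra.
      unfold RtoC. rewrite rot_mult, Ropp_0. reflexivity. }
  assert (HGgrow : forall z, Cmod (G z) <= K * exp (2 * s' * Cmod z)).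
  { intros [u v]. rewrite MG. eapply Rle_trans. { apply Rmult_le_compat_r; [apply Rlt_le, exp_pos|apply HK]. }
    rewrite Rmult_assoc, <- exp_plus. apply Rmult_le_compat_l; [assumption|]. apply exp_le.
    assert (A2 := im_le_Cmod (u, v)). simpl in A2. apply Rabs_le_between in A2. nra. }
  assert (Hup : forall u v, 0 <= v -> Cmod (G (u, v)) <= M0).
  { intros u v Hv. destruct (Rle_lt_dec 0 u) as [Hu|Hu].
    - apply (quadrant_phragmen_lindelof G K (2 * s') M0); simpl; try (unfold M0; lra); try assumption.
      intros t Ht. split; [apply Hreal|apply Himag, Ht].
    - replace (u, v) with (Ci * (v, (- u)%R))%C by (rewrite rot_mult, Ropp_involutive; reflexivity).
      apply (quadrant_phragmen_lindelof (fun z => G (Ci * z)%C) K (2 * s') M0); simpl; try (unfold M0; lra); try assumption.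
      + intros z. apply (cdiff_comp G (fun z => Ci * z)%C); [apply HG|prove_cdiff].
      + intros [p q]. rewrite rot_mult, <- (Cmod_rot p q). apply HGgrow.
      + intros t Ht. rewrite !rot_mult, Ropp_0. split; [apply Himag, Ht|apply Hreal]. }
  assert (HGM : Cmod (G (x, y)) <= M).
  { assert (Lim2 : forall t, 0 < t < / (y + 1) -> Cmod (G (x, y)) <= M * exp (M0 / M * t * y)).
    { intros t [Ht Ht1]. set (k := M0 / M * t).
      set (H := fun z => (G z * cexp (Ci * (RtoC k * z)))%C).
      assert (HH : entire H) by (intros z; unfold H; prove_cdiff; apply HG).
      assert (MH : forall u v, Cmod (H (u, v)) = Cmod (G (u, v)) * exp (- (k * v))).
      { intros u v. unfold H. rewrite Cmod_mult, Cmod_cexp. do 2 f_equal. simpl. ring. }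
      assert (Hm0 : 0 < M0 / M) by (apply Rdiv_lt_0_compat; unfold M0; lra).
      assert (Hk : 0 < k) by (apply Rmult_lt_0_compat; assumption).
      assert (HyT : y <= / t).
      { apply Rlt_le. apply (Rlt_trans _ (y + 1)); [lra|]. rewrite <- (Rinv_inv (y + 1)).
        apply Rinv_0_lt_contravar; assumption. }
      assert (HHM : Cmod (H (x, y)) <= M).
      { apply (strip_phragmen_lindelof false H M0 0 M 0 (/ t)); simpl; try lra; try discriminate.
        - exact HH.
        - intros [u v] Hv. simpl in Hv. rewrite Rmult_0_l, exp_0, Rmult_1_r, MH.
          specialize (Hup u v ltac:(lra)). assert (0 <= Cmod (G (u, v))) by apply Cmod_ge_0.
          assert (exp (- (k * v)) <= 1) by (apply exp_le_1; nra). nra.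
        - intros u _. rewrite !MH. split.
          + rewrite Rmult_0_r, Ropp_0, exp_0, Rmult_1_r, MG, Rmult_0_r, Ropp_0, exp_0, Rmult_1_r. apply HR.
          + assert (Hti : 0 < / t) by (apply Rinv_0_lt_compat; assumption).
            specialize (Hup u (/ t) ltac:(lra)).
            replace (k * / t) with (M0 / M) by (unfold k; field; lra).
            rewrite exp_Ropp. apply Rle_div_l; [apply exp_pos|].
            assert (He := exp_ineq1 (M0 / M) ltac:(lra)).
            assert (E : M * (M0 / M) = M0) by (field; lra). nra. }
      rewrite MH in HHM. apply le_exp_transfer, HHM. }
    assert (L := le_limit_right (fun t => M * exp (M0 / M * t * y)) (Cmod (G (x, y))) (/ (y + 1))).
    simpl in L. rewrite Rmult_0_r, Rmult_0_l, exp_0 in L.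
    eapply Rle_trans; [apply L|]; [apply Rinv_0_lt_compat; lra|auto_derive; auto|exact Lim2|lra]. }
  rewrite MG in HGM. apply le_exp_transfer, HGM. }
assert (L := le_limit_right (fun eps => M * exp ((s + eps) * y)) (Cmod (F (x, y))) 1 Rlt_0_1).
simpl in L. rewrite Rplus_0_r in L.
apply L; [auto_derive; auto|exact Lim].
Qed.

Theorem growth_off_real_axis F s M : entire F -> 0 <= s -> 0 < M ->
  (forall eps, 0 < eps -> growth_le (s + eps) F) -> (forall t, Cmod (F (t, 0)) <= M) ->
  forall x y, Cmod (F (x, y)) <= M * exp (s * Rabs y).
Proof.
intros HF Hs HM Hgrow HR x y. destruct (Rle_lt_dec 0 y) as [Hy|Hy].
- rewrite Rabs_pos_eq by assumption. apply upper_half_plane_bound; assumption.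
- rewrite Rabs_left by assumption.
  assert (E : forall u v, (- (u, v))%C = (- u, - v)) by reflexivity.
  replace (x, y) with (- ((- x)%R, (- y)%R))%C by (rewrite E, !Ropp_involutive; reflexivity).
  apply (upper_half_plane_bound (fun z => F (- z)%C)); try assumption; try lra.
  + intros z. apply (cdiff_comp F (fun z => - z)%C); [apply HF|prove_cdiff].
  + intros eps He. destruct (Hgrow eps He) as [K HK]. exists K. intros z. rewrite <- (Cmod_opp z). apply HK.
  + intros t. rewrite E, Ropp_0. apply HR.
Qed.


(** * Chebyshev polynomials and the confining ellipse *)

Lemma complex_sqrt (w : C) : exists v : C, (v * v)%C = w.
Proof.
destruct w as [a b]. set (m := Cmod (a, b)).
assert (Hm : m ^ 2 = a ^ 2 + b ^ 2) by (apply (Cmod2_alt (a, b))).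
assert (Ha : Rabs a <= m) by apply (re_le_Cmod (a, b)). apply Rabs_le_between in Ha.
set (p := sqrt ((m + a) / 2)). set (q := sqrt ((m - a) / 2)).
assert (Hp : p * p = (m + a) / 2) by (apply sqrt_sqrt; lra).
assert (Hq : q * q = (m - a) / 2) by (apply sqrt_sqrt; lra).
assert (Hpq : p * q = Rabs b / 2).
{ unfold p, q. rewrite <- sqrt_mult by lra.
  replace ((m + a) / 2 * ((m - a) / 2)) with (Rsqr (b / 2)) by (unfold Rsqr; nra).
  rewrite sqrt_Rsqr_abs. unfold Rdiv. rewrite Rabs_mult, (Rabs_pos_eq (/ 2)); lra. }
destruct (Rle_lt_dec 0 b) as [Hb|Hb].
- rewrite Rabs_pos_eq in Hpq by assumption. exists (p, q). apply injective_projections; simpl; lra.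
- rewrite Rabs_left in Hpq by assumption. exists (p, - q). apply injective_projections; simpl; lra.
Qed.

Lemma Cinv_unique (a b : C) : (a * b)%C = RtoC 1 -> (/ a)%C = b.
Proof.
intros H. assert (Ha : a <> 0). { intros ->. rewrite Cmult_0_l in H. apply C1_nz. symmetry. exact H. }
rewrite <- (Cmult_1_r (/ a)), <- H. field. exact Ha.
Qed.

(** The two solutions u of the quadratic equation have product 1. *)
Lemma joukowski (w : C) : exists u : C, 1 <= Cmod u /\ w = ((u + / u) / 2)%C.
Proof.
destruct (complex_sqrt (w * w - 1)%C) as [v Hv].
assert (Hprod : ((w + v) * (w - v))%C = 1%C).
{ replace ((w + v) * (w - v))%C with (w * w - v * v)%C by ring. rewrite Hv. ring. }
assert (Hmod : Cmod (w + v) * Cmod (w - v) = 1) by (rewrite <- Cmod_mult, Hprod; apply Cmod_1).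
assert (P1 := Cmod_ge_0 (w + v)). assert (P2 := Cmod_ge_0 (w - v)).
destruct (Rle_lt_dec 1 (Cmod (w + v))) as [L|L].
- exists (w + v)%C. split; [assumption|]. rewrite (Cinv_unique _ _ Hprod). field.
- exists (w - v)%C. split; [nra|]. rewrite Cmult_comm in Hprod. rewrite (Cinv_unique _ _ Hprod). field.
Qed.

(** The Chebyshev polynomials of the first kind. *)
Fixpoint cheb (n : nat) (w : C) : C :=
  match n with
  | O => 1
  | S m => match m with O => w | S k => 2 * w * cheb m w - cheb k w end
  end%C.

Lemma cheb_rec n w : cheb (S (S n)) w = (2 * w * cheb (S n) w - cheb n w)%C.
Proof. reflexivity. Qed.
Lemma pair_induction (P : nat -> Prop) : P O -> P 1%nat -> (forall n, P n -> P (S n) -> P (S (S n))) -> forall n, P n.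
Proof.
intros H0 H1 H2 n. enough (P n /\ P (S n)) by tauto. induction n as [|n [I1 I2]]; auto.
Qed.

Lemma cheb_entire n F : entire F -> entire (fun z => cheb n (F z)).
Proof.
intros HF. induction n using pair_induction; intros z.
- exact (cdiff_const (RtoC 1) z).
- exact (HF z).
- specialize (IHn z). specialize (IHn0 z).
  apply (cdiff_minus (fun z => 2 * F z * cheb (S n) (F z))%C (fun z => cheb n (F z))); [|assumption].
  apply (cdiff_mult (fun z => 2 * F z)%C (fun z => cheb (S n) (F z))); [|assumption].
  apply (cdiff_mult (fun _ => RtoC 2) F); [apply cdiff_const|apply HF].
Qed.
Lemma cheb_joukowski n (u : C) : u <> 0 -> cheb n ((u + / u) / 2) = ((u ^ n + / u ^ n) / 2)%C.
Proof.
intros Hu. induction n using pair_induction.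
- simpl. field.
- simpl. field. exact Hu.
- rewrite cheb_rec, IHn, IHn0. assert (Hp := Cpow_nz u n Hu). simpl. field. auto.
Qed.
Lemma cheb_cos n t : cheb n (RtoC (cos t)) = RtoC (cos (INR n * t)).
Proof.
induction n using pair_induction.
- simpl. rewrite Rmult_0_l, cos_0. reflexivity.
- simpl. rewrite Rmult_1_l. reflexivity.
- rewrite cheb_rec, IHn, IHn0. rewrite !S_INR.
  replace ((INR n + 1 + 1) * t) with ((INR n + 1) * t + t) by ring.
  replace (INR n * t) with ((INR n + 1) * t - t) by ring.
  rewrite cos_plus, cos_minus. apply injective_projections; simpl; ring.
Qed.
Lemma cheb_growth n w : Cmod (cheb n w) <= (2 * Cmod w + 1) ^ n.
Proof.
assert (P := Cmod_ge_0 w). induction n using pair_induction.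
- simpl. rewrite Cmod_1. lra.
- simpl. lra.
- rewrite cheb_rec. eapply Rle_trans; [apply Cmod_triangle|]. rewrite Cmod_opp, !Cmod_mult, Cmod_R, Rabs_pos_eq by lra.
  set (A := 2 * Cmod w + 1) in *.
  assert (0 <= A ^ n) by (apply pow_le; unfold A; lra).
  assert (A ^ n <= A ^ S n) by (simpl; unfold A in *; nra).
  assert (2 * Cmod w * Cmod (cheb (S n) w) <= 2 * Cmod w * A ^ S n) by (apply Rmult_le_compat_l; lra).
  replace (A ^ S (S n)) with (2 * Cmod w * A ^ S n + A ^ S n) by (unfold A; simpl; ring). lra.
Qed.
Lemma cheb_real_bound n (w : C) : Im w = 0 -> Cmod w <= 1 -> Cmod (cheb n w) <= 1.
Proof.
intros Hi Hw. assert (Hr := re_le_Cmod w).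
assert (Hb : -1 <= Re w <= 1) by (apply Rabs_le_between; lra).
replace w with (RtoC (cos (acos (Re w)))).
- rewrite cheb_cos, Cmod_R. apply Rabs_le, COS_bound.
- rewrite cos_acos by assumption. destruct w; simpl in *. unfold RtoC. rewrite Hi. reflexivity.
Qed.

Lemma exp_INR n x : exp (INR n * x) = exp x ^ n.
Proof.
induction n as [|n IH]. simpl. rewrite Rmult_0_l. apply exp_0.
rewrite S_INR, Rmult_plus_distr_r, exp_plus, IH, Rmult_1_l. simpl. ring.
Qed.

Lemma cheb_exp_type n F s : 0 <= s -> (forall eps, 0 < eps -> growth_le (s + eps) F) ->
  forall eps, 0 < eps -> growth_le (INR n * s + eps) (fun z => cheb n (F z)).
Proof.
intros Hs H eps Heps.
assert (HN : 0 < INR n + 1) by (generalize (pos_INR n); lra).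
destruct (H (eps / (INR n + 1))) as [K HK]. { apply Rdiv_lt_0_compat; lra. }
set (b := s + eps / (INR n + 1)) in *.
assert (Hb : 0 <= b) by (unfold b; assert (0 < eps / (INR n + 1)) by (apply Rdiv_lt_0_compat; lra); lra).
exists ((2 * K + 1) ^ n). intros z. eapply Rle_trans; [apply cheb_growth|].
assert (HE : 1 <= exp (b * Cmod z)).
{ rewrite <- exp_0. apply exp_le. apply Rmult_le_pos; [assumption|apply Cmod_ge_0]. }
apply (Rle_trans _ (((2 * K + 1) * exp (b * Cmod z)) ^ n)).
- apply pow_incr. specialize (HK z). assert (0 <= Cmod (F z)) by apply Cmod_ge_0. nra.
- rewrite Rpow_mult_distr. apply Rmult_le_compat_l.
  + apply pow_le. assert (0 <= K) by (apply (bound_constant_nonneg _ _ _ (HK 0))). lra.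
  + rewrite <- exp_INR. apply exp_le. rewrite <- Rmult_assoc. apply Rmult_le_compat_r; [apply Cmod_ge_0|].
    unfold b. assert (INR n * (eps / (INR n + 1)) <= eps).
    { replace eps with ((INR n + 1) * (eps / (INR n + 1))) at 2 by (field; lra).
      apply Rmult_le_compat_r; [|lra]. apply Rlt_le, Rdiv_lt_0_compat; lra. }
    lra.
Qed.

Lemma le_of_pow_bounded rho E K : 0 <= rho -> 0 < E -> (forall n, rho ^ n <= K * E ^ n) -> rho <= E.
Proof.
intros Hr HE H. apply Rnot_lt_le. intros Hlt.
set (t := rho / E - 1).
assert (Ht : 0 < t). { unfold t. assert (1 < rho / E) by (apply Rlt_div_r; lra). lra. }
assert (Hn : forall n, 1 + INR n * t <= K).
{ intros n. eapply Rle_trans; [apply poly; assumption|].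
  replace (1 + t) with (rho * / E) by (unfold t; field; lra).
  rewrite Rpow_mult_distr, pow_inv. apply Rle_div_l; [apply pow_lt; assumption|apply H]. }
destruct (INR_unbounded (K / t)) as [n HNn]. specialize (Hn n).
apply Rlt_div_l in HNn; [|assumption]. lra.
Qed.

Lemma inv_sum_mono a b : 1 <= a <= b -> a + / a <= b + / b /\ 0 <= a - / a <= b - / b.
Proof.
intros H.
assert (Hi : / b <= / a) by (apply Rinv_le_contravar; lra).
assert (Ha : / a <= 1) by (rewrite <- Rinv_1; apply Rinv_le_contravar; lra).
assert (E : b + / b - (a + / a) = (b - a) * (1 - / a * / b)) by (field; lra).
assert (0 < / b) by (apply Rinv_0_lt_compat; lra).
assert (0 < / a) by (apply Rinv_0_lt_compat; lra).
assert (/ a * / b <= 1) by nra. split; nra.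
Qed.

(** Write F(z) = (u + 1/u) / 2 with |u| >= 1.  Then T_n(F(z)) = (u^n + u^(-n)) / 2 has modulus at least
    (|u|^n - 1) / 2 and at most e^(n s |y|) for every n, which forces |u| <= e^(s |y|).  The points
    with this property fill the ellipse. *)
Lemma ellipse_bound F s : entire F -> real_on_R F -> 0 <= s ->
  (forall eps, 0 < eps -> growth_le (s + eps) F) -> (forall t, Cmod (F (RtoC t)) <= 1) ->
  forall x y, Re (F (x, y)) ^ 2 * sinh (s * y) ^ 2 + Im (F (x, y)) ^ 2 * cosh (s * y) ^ 2
    <= sinh (s * y) ^ 2 * cosh (s * y) ^ 2.
Proof.
intros HF Hreal Hs Hg Hb x y.
set (w := F (x, y)). set (E := exp (s * Rabs y)).
assert (HE : 0 < E) by apply exp_pos.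
assert (HE1 : 1 <= E). { unfold E. rewrite <- exp_0. apply exp_le, Rmult_le_pos; [assumption|apply Rabs_pos]. }
destruct (joukowski w) as [u [Hu1 Hw]].
assert (Hu0 : u <> 0) by (apply Cmod_gt_0; lra).
assert (HuE : Cmod u <= E).
{ apply (le_of_pow_bounded _ _ 3); [lra|assumption|]. intros n.
  assert (Hn : Cmod (cheb n w) <= 1 * exp (INR n * s * Rabs y)).
  { apply (growth_off_real_axis (fun z => cheb n (F z)) (INR n * s) 1).
    - apply cheb_entire, HF. - apply Rmult_le_pos; [apply pos_INR|assumption]. - lra.
    - apply cheb_exp_type; assumption.
    - intros t. apply cheb_real_bound; [apply Hreal|apply Hb]. }
  rewrite Rmult_1_l, Rmult_assoc, exp_INR in Hn. fold E in Hn.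
  rewrite Hw, cheb_joukowski in Hn by assumption.
  assert (Hpn : (u ^ n)%C <> 0) by (apply Cpow_nz, Hu0).
  assert (Hup : 1 <= Cmod u ^ n) by (apply pow_R1_Rle; assumption).
  assert (Hpi : Cmod (/ u ^ n) <= 1).
  { rewrite Cmod_inv, Cmod_pow by assumption. rewrite <- Rinv_1. apply Rinv_le_contravar; lra. }
  assert (Htri : Cmod (u ^ n) <= Cmod (u ^ n + / u ^ n) + Cmod (/ u ^ n)).
  { replace (u ^ n)%C with ((u ^ n + / u ^ n) + - (/ u ^ n))%C at 1 by ring.
    eapply Rle_trans; [apply Cmod_triangle|]. rewrite Cmod_opp. lra. }
  rewrite Cmod_div, Cmod_R, Rabs_pos_eq in Hn; try lra. 2: { intros K. apply RtoC_inj in K. lra. }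
  rewrite Cmod_pow in Htri. assert (1 <= E ^ n) by (apply pow_R1_Rle; assumption). lra. }
destruct (inv_sum_mono (Cmod u) E) as [K1 K2]; [lra|].
set (rho := Cmod u) in *.
assert (Hrho : rho ^ 2 = Re u ^ 2 + Im u ^ 2) by apply Cmod2_alt.
destruct u as [p q]. simpl in Hrho.
assert (Hrho' : rho * rho = p * p + q * q) by lra.
assert (Hre : Re w = p / rho * ((rho + / rho) / 2)).
{ rewrite Hw. simpl. rewrite !Rmult_1_r, <- Hrho'. field. lra. }
assert (Him : Im w = q / rho * ((rho - / rho) / 2)).
{ rewrite Hw. simpl. rewrite !Rmult_1_r, <- Hrho'. field. lra. }
assert (HAB : (p / rho) ^ 2 + (q / rho) ^ 2 = 1).
{ replace ((p / rho) ^ 2 + (q / rho) ^ 2) with ((p * p + q * q) / (rho * rho)) by (field; lra). rewrite <- Hrho'. field. lra. }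
assert (Hc : cosh (s * y) ^ 2 = ((E + / E) / 2) ^ 2).
{ unfold cosh, E. rewrite <- exp_Ropp. unfold Rabs. destruct Rcase_abs; [|reflexivity].
  replace (s * - y) with (- (s * y)) by ring. rewrite Ropp_involutive, Rplus_comm. reflexivity. }
assert (Hsh : sinh (s * y) ^ 2 = ((E - / E) / 2) ^ 2).
{ unfold sinh, E. rewrite <- exp_Ropp. unfold Rabs. destruct Rcase_abs; [|reflexivity].
  replace (s * - y) with (- (s * y)) by ring. rewrite Ropp_involutive. field. }
rewrite Hc, Hsh, Hre, Him.
set (c0 := (E + / E) / 2). set (s0 := (E - / E) / 2). set (c1 := (rho + / rho) / 2). set (s1 := (rho - / rho) / 2).
assert (L1 : c1 ^ 2 <= c0 ^ 2).
{ apply pow_incr. unfold c0, c1. assert (0 < / rho) by (apply Rinv_0_lt_compat; lra). lra. }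
assert (L2 : s1 ^ 2 <= s0 ^ 2) by (apply pow_incr; unfold s0, s1; lra).
rewrite !Rpow_mult_distr. set (A := (p / rho) ^ 2) in *. set (B := (q / rho) ^ 2) in *.
assert (0 <= A) by apply pow2_ge_0. assert (0 <= B) by apply pow2_ge_0.
assert (0 <= s0 ^ 2) by apply pow2_ge_0. assert (0 <= c0 ^ 2) by apply pow2_ge_0.
assert (A * c1 ^ 2 * s0 ^ 2 <= A * c0 ^ 2 * s0 ^ 2).
{ apply Rmult_le_compat_r; [assumption|]. apply Rmult_le_compat_l; assumption. }
assert (B * s1 ^ 2 * c0 ^ 2 <= B * s0 ^ 2 * c0 ^ 2).
{ apply Rmult_le_compat_r; [assumption|]. apply Rmult_le_compat_l; assumption. }
replace (s0 ^ 2 * c0 ^ 2) with ((A + B) * (s0 ^ 2 * c0 ^ 2)) by (rewrite HAB; ring). lra.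
Qed.

Lemma cosh_le t u : 0 <= t <= u -> cosh t <= cosh u.
Proof.
intros H. unfold cosh. rewrite !exp_Ropp. destruct (inv_sum_mono (exp t) (exp u)) as [K _]; [|lra].
rewrite <- exp_0. split; apply exp_le; lra.
Qed.
Lemma cosh_ge_1 t : 0 <= t -> 1 <= cosh t.
Proof. intros H. rewrite <- cosh_0. apply cosh_le. lra. Qed.

Lemma sinh_bounds t : 0 <= t -> t <= sinh t <= t * cosh t.
Proof.
intros Ht.
destruct (MVT_gen sinh 0 t cosh) as [c [Hc E]].
- intros x _. unfold sinh, cosh. auto_derive; [auto|]. unfold Rdiv. ring_simplify. reflexivity.
- intros x _. apply derivable_continuous_pt, derivable_pt_sinh.
- rewrite Rmin_left, Rmax_right in Hc by lra. rewrite sinh_0, !Rminus_0_r in E.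
  assert (Hone := cosh_ge_1 c (proj1 Hc)). assert (Hmono := cosh_le c t Hc).
  rewrite E. split; nra.
Qed.

(** * The inequality of Bernstein and Szego *)

(** Divide [ellipse_bound] by y^2 and let y > 0 tend to 0: Re F(x + iy) tends to F(x) and
    Im F(x + iy) / y to F'(x), as F is real on the line, while sinh (s y) / y tends to s. *)
Lemma bernstein_szego_unit F s x l : entire F -> real_on_R F -> 0 <= s ->
  (forall eps, 0 < eps -> growth_le (s + eps) F) -> (forall t, Cmod (F (RtoC t)) <= 1) ->
  is_cderive F (RtoC x) l -> Re l ^ 2 + s ^ 2 * Re (F (RtoC x)) ^ 2 <= s ^ 2.
Proof.
intros HF Hreal Hs Hg Hb Hl.
assert (Hell := ellipse_bound F s HF Hreal Hs Hg Hb).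
rewrite is_cderive_eps in Hl.
set (A := Rabs (Re (F (RtoC x)))). set (B := Rabs (Re l)).
assert (HA : 0 <= A) by apply Rabs_pos. assert (HB : 0 <= B) by apply Rabs_pos.
set (L := Cmod l + 1).
assert (HL : 0 <= L) by (unfold L; generalize (Cmod_ge_0 l); lra).
assert (Main : forall eps, 0 < eps < 1 -> B ^ 2 <= s ^ 2 - s ^ 2 * A ^ 2 + 2 * B * eps).
{ intros eps [Heps Heps1]. destruct (Hl eps Heps) as [delta [Hd HD]].
  assert (Lim : forall y, 0 < y < delta ->
    B ^ 2 <= s ^ 2 * cosh (s * y) ^ 4 - s ^ 2 * (A ^ 2 - 2 * A * y * L) + 2 * B * eps).
  { intros y Hy. set (w := F (x, y)).
    assert (Ew : ((x, y) - RtoC x)%C = (0, y)) by (apply injective_projections; simpl; ring).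
    assert (Em : Cmod (0, y) = y).
    { replace (0, y) with (Ci * RtoC y)%C by (apply injective_projections; simpl; ring).
      rewrite Cmod_mult, Cmod_Ci, Cmod_R, Rabs_pos_eq; lra. }
    specialize (HD (x, y)). rewrite Ew, Em in HD. specialize (HD ltac:(lra)). fold w in HD.
    assert (Hre := Rle_trans _ _ _ (re_le_Cmod _) HD). assert (Him := Rle_trans _ _ _ (im_le_Cmod _) HD).
    specialize (Hreal x). destruct l as [l1 l2].
    assert (Hl1 : Rabs l1 <= Cmod (l1, l2)) by apply (re_le_Cmod (l1, l2)).
    assert (Hl2 : Rabs l2 <= Cmod (l1, l2)) by apply (im_le_Cmod (l1, l2)).
    specialize (Hell x y). fold w in Hell. unfold A, B in *. clear HD.
    set (f0 := F (RtoC x)) in *. clearbody f0 w. destruct f0 as [f1 f2]. destruct w as [a b].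
    simpl in Hreal, Hre, Him, Hell |- *. fold L in Hl2. subst f2.
    assert (Hre' : Rabs (f1 - a) <= y * L).
    { replace (f1 - a) with (- (a + - f1 + - (0 * l1 - y * l2)) + - (- y * l2)) by ring.
      unfold L. eapply Rle_trans; [apply Rabs_triang|]. rewrite !Rabs_Ropp, Rabs_mult, Rabs_Ropp, (Rabs_pos_eq y) by lra.
      nra. }
    assert (Him' : Rabs (y * l1 - b) <= eps * y).
    { replace (y * l1 - b) with (- (b + - 0 + - (0 * l2 + y * l1))) by ring. rewrite Rabs_Ropp. exact Him. }
    assert (Ha : Rabs f1 <= Rabs a + y * L).
    { replace f1 with (a + (f1 - a)) at 1 by ring. eapply Rle_trans; [apply Rabs_triang|]. lra. }
    assert (Hbb : y * Rabs l1 <= Rabs b + eps * y).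
    { rewrite <- (Rabs_pos_eq y) at 1 by lra. rewrite <- Rabs_mult.
      replace (y * l1) with (b + (y * l1 - b)) at 1 by ring. eapply Rle_trans; [apply Rabs_triang|]. lra. }
    rewrite !Rmult_1_r in *.
    assert (Hsq : forall r, r * r = Rabs r * Rabs r) by (intros r; rewrite <- Rabs_mult, Rabs_pos_eq; nra).
    assert (Ha2 : Rabs f1 * Rabs f1 - 2 * Rabs f1 * y * L <= a * a).
    { rewrite (Hsq a). assert (0 <= Rabs f1) by apply Rabs_pos. assert (0 <= Rabs a) by apply Rabs_pos.
      destruct (Rle_lt_dec (Rabs f1) (y * L)) as [C1|C1].
      - assert (0 <= Rabs a * Rabs a) by nra. nra.
      - assert (0 <= Rabs f1 - y * L <= Rabs a) by lra. nra. }
    assert (Hb2 : y * y * (Rabs l1 * Rabs l1 - 2 * Rabs l1 * eps) <= b * b).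
    { rewrite (Hsq b). assert (0 <= Rabs l1) by apply Rabs_pos.
      assert (0 <= Rabs b) by apply Rabs_pos.
      destruct (Rle_lt_dec (Rabs l1) eps) as [C1|C1].
      - assert (Rabs l1 * Rabs l1 - 2 * Rabs l1 * eps <= 0) by nra. assert (0 <= y * y) by nra. nra.
      - assert (0 <= y * (Rabs l1 - eps) <= Rabs b) by nra. nra. }
    destruct (sinh_bounds (s * y)) as [S1 S2]; [nra|].
    set (sh := sinh (s * y)) in *. set (ch := cosh (s * y)) in *.
    assert (Hch : 1 <= ch).
    { apply cosh_ge_1. nra. }
    assert (Hyy : 0 < y * y) by nra.
    assert (Hsy : 0 <= s * y) by nra.
    assert (Hss : (s * y) * (s * y) = s * s * (y * y)) by ring.
    set (k := s * y) in *. clearbody k sh ch.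
    assert (T1 : k * k <= sh * sh) by (apply Rmult_le_compat; lra).
    assert (T2 : sh * sh <= (k * ch) * (k * ch)) by (apply Rmult_le_compat; lra).
    assert (T3 : 1 <= ch * ch) by nra.
    assert (U1 : (Rabs f1 * Rabs f1 - 2 * Rabs f1 * y * L) * (k * k) <= a * a * (sh * sh)).
    { apply (Rle_trans _ (a * a * (k * k))).
      - apply Rmult_le_compat_r; [nra|assumption].
      - apply Rmult_le_compat_l; [nra|assumption]. }
    assert (U2 : y * y * (Rabs l1 * Rabs l1 - 2 * Rabs l1 * eps) <= b * b * (ch * ch)).
    { assert (0 <= b * b) by nra. nra. }
    assert (U3 : sh * sh * (ch * ch) <= (k * ch) * (k * ch) * (ch * ch)) by (apply Rmult_le_compat_r; lra).
    apply (Rmult_le_reg_l (y * y)); [assumption|].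
    set (X := Rabs f1 * Rabs f1 - 2 * Rabs f1 * y * L) in *.
    set (Z := Rabs l1 * Rabs l1 - 2 * Rabs l1 * eps) in *.
    assert (V : X * (k * k) + y * y * Z <= k * k * (ch * ch * (ch * ch))) by lra.
    rewrite Hss in V.
    assert (V2 : y * y * (Z + 2 * Rabs l1 * eps) <= y * y * (s * s * (ch * ch * (ch * ch)) - s * s * X + 2 * Rabs l1 * eps)) by lra.
    unfold X, Z in V2 |- *. eapply Rle_trans; [|eapply Rle_trans; [exact V2|]]; apply Req_le; ring. }
  assert (Lf := le_limit_right (fun y => s ^ 2 * cosh (s * y) ^ 4 - s ^ 2 * (A ^ 2 - 2 * A * y * L) + 2 * B * eps)
    (B ^ 2) delta Hd).
  cbv beta in Lf. rewrite !Rmult_0_r, cosh_0 in Lf.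
  eapply Rle_trans; [apply Lf|]; [unfold cosh; auto_derive; auto|exact Lim|simpl; lra]. }
assert (Lf := le_limit_right (fun eps => s ^ 2 - s ^ 2 * A ^ 2 + 2 * B * eps) (B ^ 2) 1 Rlt_0_1).
cbv beta in Lf. specialize (Lf ltac:(auto_derive; auto) Main). unfold A, B in Lf. rewrite !pow2_abs in Lf. lra.
Qed.


(** * The case of equality *)

Definition ccos (z : C) : C := (RtoC (/ 2) * (cexp (Ci * z) + cexp (- Ci * z)))%C.
Definition csin (z : C) : C := ((0, (- / 2)%R) * (cexp (Ci * z) - cexp (- Ci * z)))%C.

Lemma ccos_parts x y : ccos (x, y) = (cos x * cosh y, - (sin x * sinh y)).
Proof.
unfold ccos, cexp, cosh, sinh, Ci. apply injective_projections; simpl.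
- replace (0 * x - 1 * y) with (- y) by ring. replace (- 0 * x - - (1) * y) with y by ring.
  replace (0 * y + 1 * x) with x by ring. replace (- 0 * y + - (1) * x) with (- x) by ring.
  rewrite cos_neg, sin_neg. field.
- replace (0 * x - 1 * y) with (- y) by ring. replace (- 0 * x - - (1) * y) with y by ring.
  replace (0 * y + 1 * x) with x by ring. replace (- 0 * y + - (1) * x) with (- x) by ring.
  rewrite cos_neg, sin_neg. field.
Qed.
Lemma csin_parts x y : csin (x, y) = (sin x * cosh y, cos x * sinh y).
Proof.
unfold csin, cexp, cosh, sinh, Ci. apply injective_projections; simpl.
- replace (0 * x - 1 * y) with (- y) by ring. replace (- 0 * x - - (1) * y) with y by ring.
  replace (0 * y + 1 * x) with x by ring. replace (- 0 * y + - (1) * x) with (- x) by ring.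
  rewrite cos_neg, sin_neg. field.
- replace (0 * x - 1 * y) with (- y) by ring. replace (- 0 * x - - (1) * y) with y by ring.
  replace (0 * y + 1 * x) with x by ring. replace (- 0 * y + - (1) * x) with (- x) by ring.
  rewrite cos_neg, sin_neg. field.
Qed.

Lemma is_cderive_linear (a b z : C) : is_cderive (fun w => a * w + b)%C z a.
Proof.
apply is_cderive_eps. intros eps He. exists 1; split; [lra|]. intros w _.
replace (a * w + b - (a * z + b) - (w - z) * a)%C with (RtoC 0) by ring. rewrite Cmod_0.
apply Rmult_le_pos; [lra|apply Cmod_ge_0].
Qed.
Lemma is_cderive_exp_linear (a z : C) : is_cderive (fun w => cexp (a * w)) z (a * cexp (a * z))%C.
Proof.
apply (is_cderive_comp cexp (fun w => a * w)%C); [apply is_cderive_exp|].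
assert (H := is_cderive_linear a 0 z).
eapply is_derive_ext; [|exact H]. intros t. apply Cplus_0_r.
Qed.
Lemma is_cderive_scal (a : C) f z l : is_cderive f z l -> is_cderive (fun w => a * f w)%C z (a * l)%C.
Proof.
intros H. assert (K := is_cderive_mult (fun _ => a) f z _ _ (is_derive_const a z) H). cbv beta in K.
replace (a * l)%C with (zero * f z + a * l)%C; [exact K|]. unfold zero; simpl. ring.
Qed.
Lemma is_cderive_cos z : is_cderive ccos z (- csin z)%C.
Proof.
assert (H := is_cderive_scal (RtoC (/ 2)) _ z _
  (is_cderive_plus _ _ _ _ _ (is_cderive_exp_linear Ci z) (is_cderive_exp_linear (- Ci) z))).
cbv beta in H.
replace (- csin z)%C with (RtoC (/ 2) * (Ci * cexp (Ci * z) + - Ci * cexp (- Ci * z)))%C; [exact H|].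
unfold csin, Ci. apply injective_projections; simpl; ring.
Qed.
Lemma csin_cdiff z : cdiff csin z.
Proof. unfold csin. prove_cdiff. Qed.
Lemma ccos_cdiff z : cdiff ccos z.
Proof. eexists. apply is_cderive_cos. Qed.

Lemma exists_phase a b : a ^ 2 + b ^ 2 = 1 -> exists t, cos t = a /\ sin t = b.
Proof.
intros H. assert (Ha : -1 <= a <= 1) by nra.
assert (Hs : sqrt (1 - a * a) = Rabs b).
{ replace (1 - a * a) with (Rsqr b) by (unfold Rsqr; nra). apply sqrt_Rsqr_abs. }
destruct (Rle_lt_dec 0 b) as [Hb|Hb].
- exists (acos a). rewrite cos_acos, sin_acos by assumption. unfold Rsqr. rewrite Hs, Rabs_pos_eq; auto.
- exists (- acos a). rewrite cos_neg, sin_neg, cos_acos, sin_acos by assumption. unfold Rsqr. rewrite Hs, Rabs_left; lra.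
Qed.

Lemma polar (q z : C) : z <> q -> exists t, 0 <= t < 2 * PI /\ z = circle q (Cmod (z - q)) t.
Proof.
intros Hz. set (r := Cmod (z - q)).
assert (Hr : 0 < r).
{ apply Cmod_gt_0. intros E. apply Hz. replace z with ((z - q) + q)%C by ring. rewrite E. ring. }
assert (HPI := PI_RGT_0).
assert (Hrr : r ^ 2 = Re (z - q) ^ 2 + Im (z - q) ^ 2) by apply Cmod2_alt.
set (a := Re (z - q) / r). set (b := Im (z - q) / r).
assert (Hab : a ^ 2 + b ^ 2 = 1).
{ unfold a, b. replace ((Re (z - q) / r) ^ 2 + (Im (z - q) / r) ^ 2) with ((Re (z - q) ^ 2 + Im (z - q) ^ 2) / r ^ 2) by (field; lra).
  rewrite <- Hrr. field. lra. }
assert (Ha : -1 <= a <= 1) by nra.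
assert (Hs : sqrt (1 - a * a) = Rabs b).
{ replace (1 - a * a) with (Rsqr b) by (unfold Rsqr; nra). apply sqrt_Rsqr_abs. }
assert (Hex : exists t, 0 <= t < 2 * PI /\ cos t = a /\ sin t = b).
{ destruct (acos_bound a) as [B1 B2].
  assert (Hsin : sin (acos a) = Rabs b) by (rewrite sin_acos by assumption; unfold Rsqr; exact Hs).
  destruct (Rle_lt_dec 0 b) as [Hb|Hb].
  - exists (acos a). rewrite cos_acos, Hsin by assumption. rewrite Rabs_pos_eq by assumption. repeat split; lra.
  - exists (2 * PI - acos a). rewrite cos_minus, sin_minus, cos_2PI, sin_2PI, cos_acos, Hsin by assumption.
    rewrite Rabs_left in * by assumption.
    repeat split; try lra. destruct (Rle_lt_or_eq_dec 0 (acos a) B1) as [L|E]; [lra|].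
    rewrite <- E, sin_0 in Hsin. lra. }
destruct Hex as (t & Ht & Hc & Hsn). exists t. split; [assumption|].
unfold circle. rewrite Hc, Hsn. unfold a, b. apply injective_projections; simpl; unfold Re, Im; simpl; field; lra.
Qed.

Lemma cosh_pos t : 0 < cosh t.
Proof. unfold cosh. assert (H1 := exp_pos t). assert (H2 := exp_pos (- t)). lra. Qed.

(** A holomorphic function whose imaginary part has the sign of y cannot vanish to second order at a
    real point unless it is 0: the mean of sin u Im p over a circle around the point is a multiple of
    Re p'(x) = 0, and its integrand is nonnegative. *)
Lemma flat_nevanlinna_vanishes (p : C -> C) (x d : R) :
  (forall z, Cmod (z - RtoC x) < d -> cdiff p z) ->
  p (RtoC x) = 0 -> is_cderive p (RtoC x) (RtoC 0) ->
  (forall z, Cmod (z - RtoC x) < d -> 0 <= Im z * Im (p z)) ->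
  (forall a : R, Cmod (RtoC a - RtoC x) < d -> Im (p (RtoC a)) = 0) ->
  forall z, Cmod (z - RtoC x) < d -> p z = 0.
Proof.
intros Hp Hpq Hder Hsign Hreal. set (q := RtoC x) in *.
assert (Him : forall r t, 0 < r < d -> 0 <= t < 2 * PI -> Im (p (circle q r t)) = 0).
{ intros r t Hr Ht.
  destruct (Req_dec (sin t) 0) as [E|E].
  { assert (Ec : circle q r t = RtoC (x + r * cos t)).
    { unfold circle, q. rewrite E. apply injective_projections; simpl; ring. }
    assert (Hd := circle_dist q r t ltac:(lra)). rewrite Ec in *. apply Hreal. rewrite Hd. lra. }
  (* With z - q = r e^(iu), the factor 1 / (z - q) - (z - q) / r^2 is -2 i (sin u) / r, so
     that Im g = (2 / r) (sin u) Im p on the circle, while g is continuous with value 0 at q. *)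
  set (g := fun z => (Ci * (p z / (z - q) - RtoC (/ (r * r)) * (p z * (z - q))))%C).
  assert (Hgq : g q = RtoC 0) by (unfold g; rewrite Hpq; unfold Cdiv; ring).
  assert (Hgc : forall u, g (circle q r u) = (RtoC (2 * sin u / r) * p (circle q r u))%C).
  { intros u. unfold g. replace (circle q r u - q)%C with (RtoC r * (cos u, sin u))%C by (unfold circle; ring).
    set (w := p (circle q r u)).
    assert (Hinv : (/ (RtoC r * (cos u, sin u)))%C = (RtoC (/ r) * (cos u, (- sin u)%R))%C).
    { assert (Hcs : cos u * cos u + sin u * sin u = 1) by (generalize (sin2_cos2 u); unfold Rsqr; lra).
      apply Cinv_unique. apply injective_projections; simpl.
      - transitivity (r * / r * (cos u * cos u + sin u * sin u)); [ring|]. rewrite Hcs. field. lra.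
      - ring. }
    unfold Cdiv. rewrite Hinv. destruct w as [w1 w2].
    apply injective_projections; simpl; field; lra. }
  assert (Hgcont : ccont g q).
  { intros eps He. rewrite is_cderive_eps in Hder.
    destruct (Hder (eps / 2)) as [d1 [Hd1 K]]; [lra|].
    exists (Rmin d1 r). split; [apply Rmin_pos; lra|]. intros z Hz.
    assert (Z1 := Rlt_le_trans _ _ _ Hz (Rmin_l _ _)). assert (Z2 := Rlt_le_trans _ _ _ Hz (Rmin_r _ _)).
    rewrite Hgq. replace (g z - 0)%C with (g z) by ring. specialize (K z Z1).
    rewrite Hpq in K. replace (p z - 0 - (z - q) * 0)%C with (p z) in K by ring.
    destruct (classic (z = q)) as [->|Hne]; [rewrite Hgq, Cmod_0; assumption|].
    assert (Hz0 := Cmod_sub_pos z q Hne).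
    assert (Hznz : (z - q)%C <> 0) by (apply Cmod_gt_0; assumption).
    unfold g. rewrite Cmod_mult, Cmod_Ci, Rmult_1_l.
    eapply Rle_lt_trans; [apply Cmod_triangle|]. rewrite Cmod_opp, Cmod_div, !Cmod_mult, Cmod_R by assumption.
    assert (Hri : 0 < / (r * r)) by (apply Rinv_0_lt_compat; nra).
    rewrite (Rabs_pos_eq (/ (r * r))) by lra.
    set (M := Cmod (z - q)) in *. set (P := Cmod (p z)) in *.
    assert (P / M <= eps / 2) by (apply Rle_div_l; assumption).
    assert (/ (r * r) * (P * M) < eps / 2).
    { replace (/ (r * r) * (P * M)) with (P * M / (r * r)) by (field; lra). apply Rlt_div_l; [nra|].
      assert (P * M <= eps / 2 * (M * M)) by nra. assert (M * M < r * r) by nra.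
      eapply Rle_lt_trans; [eassumption|]. apply Rmult_lt_compat_l; lra. }
    lra. }
  assert (Hgd : cdiff_punctured g q r).
  { intros z Hzq' Hzr. assert (Hpz : cdiff p z) by (apply Hp; lra).
    assert (Hznz : (z - q)%C <> 0) by (apply Cmod_gt_0, Cmod_sub_pos, Hzq').
    apply (cdiff_mult (fun _ => Ci)); [apply cdiff_const|]. apply (cdiff_minus (fun z => p z / (z - q))%C).
    - apply (cdiff_div p (fun z => z - q)%C); [assumption|prove_cdiff|exact Hznz].
    - prove_cdiff. }
  assert (K := mean_value_zero g q r ltac:(lra) Hgcont Hgd).
  assert (Hnn : forall u, 0 <= Im (g (circle q r u))).
  { intros u. rewrite Hgc. assert (Hc := Hsign (circle q r u)). rewrite circle_dist in Hc by lra.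
    specialize (Hc ltac:(lra)). replace (Im (circle q r u)) with (r * sin u) in Hc by (unfold circle, q; simpl; ring).
    set (w := p (circle q r u)) in *. clearbody w. destruct w as [w1 w2]. simpl in *.
    assert (Hpos : 0 <= sin u * w2) by nra.
    replace (2 * sin u / r * w2 + 0 * w1) with (2 * (sin u * w2) / r) by (field; lra). apply Rdiv_le_0_compat; lra. }
  specialize (K Hnn ltac:(rewrite Hgq; reflexivity) t Ht). rewrite Hgc in K.
  set (w := p (circle q r t)) in *. clearbody w. destruct w as [w1 w2]. simpl in *.
  assert (Hk : (2 * sin t / r) * w2 = 0) by lra. apply Rmult_integral in Hk. destruct Hk as [Hk|Hk]; [exfalso|exact Hk].
  unfold Rdiv in Hk. apply Rmult_integral in Hk. destruct Hk as [Hk|Hk]; [lra|].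
  assert (0 < / r) by (apply Rinv_0_lt_compat; lra). lra. }
intros z Hz. destruct (classic (z = q)) as [->|Hne]; [exact Hpq|].
destruct (polar q z Hne) as (t & Ht & Ez). assert (Hr := Cmod_sub_pos z q Hne).
set (r := Cmod (z - q)) in *.
assert (Him' : forall u, Im (p (circle q r u)) = 0).
{ intros u. destruct (polar q (circle q r u)) as (v & Hv & E); [apply circle_neq_center, Hr|].
  rewrite circle_dist in E by lra. rewrite E. apply Him; [split|]; assumption. }
(* p is real on the circle, so p^2 >= 0 there, while its mean is p(q)^2 = 0. *)
set (g := fun z => (Ci * (p z * p z))%C).
assert (Hgim : forall u, Im (g (circle q r u)) = Re (p (circle q r u)) ^ 2).
{ intros u. unfold g. specialize (Him' u). destruct (p (circle q r u)) as [w1 w2]. simpl in *. rewrite Him'. ring. }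
assert (Hgd : forall w, Cmod (w - q) < d -> cdiff g w).
{ intros w Hw. assert (Hpw := Hp w Hw). unfold g. prove_cdiff. }
assert (K2 : Im (g (circle q r t)) = 0).
{ apply mean_value_zero; try assumption.
  - apply cdiff_cont, Hgd. replace (q - q)%C with (RtoC 0) by ring. rewrite Cmod_0. lra.
  - intros w _ Hw. apply Hgd. lra.
  - intros u. rewrite Hgim. apply pow2_ge_0.
  - unfold g. rewrite Hpq. simpl. ring. }
rewrite Hgim in K2. specialize (Him' t). rewrite Ez. destruct (p (circle q r t)) as [w1 w2]. simpl in K2, Him'.
apply injective_projections; simpl; [nra|exact Him'].
Qed.

(** The supporting half-plane of the ellipse at its boundary point cos (xi + i y): the outer normal is
    - i sin (xi + i y), and the inequality is that of Cauchy and Schwarz. *)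
Lemma ellipse_support (u v xi y : R) :
  u ^ 2 * sinh y ^ 2 + v ^ 2 * cosh y ^ 2 <= sinh y ^ 2 * cosh y ^ 2 ->
  0 <= y * ((v + sin xi * sinh y) * (sin xi * cosh y) - (u - cos xi * cosh y) * (cos xi * sinh y)).
Proof.
intros Hell. set (sh := sinh y) in *. assert (Hch := cosh_pos y). set (ch := cosh y) in *.
assert (Hcs : cos xi * cos xi + sin xi * sin xi = 1) by (generalize (sin2_cos2 xi); unfold Rsqr; lra).
set (X := u * cos xi * sh - v * sin xi * ch).
replace ((v + sin xi * sh) * (sin xi * ch) - (u - cos xi * ch) * (cos xi * sh))
  with (sh * ch * (cos xi * cos xi + sin xi * sin xi) - X) by (unfold X; ring).
rewrite Hcs, Rmult_1_r.
assert (HX : X ^ 2 <= (sh * ch) ^ 2).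
{ assert (E : X ^ 2 + (u * sh * sin xi + v * ch * cos xi) ^ 2 =
    (u ^ 2 * sh ^ 2 + v ^ 2 * ch ^ 2) * (cos xi * cos xi + sin xi * sin xi)) by (unfold X; ring).
  rewrite Hcs in E. assert (0 <= (u * sh * sin xi + v * ch * cos xi) ^ 2) by apply pow2_ge_0.
  replace ((sh * ch) ^ 2) with (sh ^ 2 * ch ^ 2) by ring. lra. }
destruct (Rle_lt_dec 0 y) as [B|B].
- assert (0 <= sh) by (destruct (sinh_bounds y B) as [K _]; fold sh in K; lra).
  assert (0 <= sh * ch) by nra. assert (X <= sh * ch) by nra. nra.
- assert (sh <= 0).
  { destruct (sinh_bounds (- y)) as [K _]; [lra|].
    assert (E : sinh (- y) = - sh) by (unfold sh, sinh; rewrite Ropp_involutive; field). lra. }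
  assert (sh * ch <= 0) by nra. assert (sh * ch <= X) by nra. nra.
Qed.

(** The quotient p of F - cos by sin satisfies [flat_nevanlinna_vanishes]; the sine is not 0 at x
    because |F(x)| < 1. *)
Lemma bernstein_szego_equality_unit F s x l : entire F -> real_on_R F -> 0 < s ->
  (forall eps, 0 < eps -> growth_le (s + eps) F) -> (forall t, Cmod (F (RtoC t)) <= 1) ->
  is_cderive F (RtoC x) l -> Im l = 0 -> Re l ^ 2 + s ^ 2 * Re (F (RtoC x)) ^ 2 = s ^ 2 ->
  Rabs (Re (F (RtoC x))) < 1 ->
  exists theta, forall t, Re (F (RtoC t)) = cos (s * (t - x) + theta).
Proof.
intros HF Hreal Hs Hg Hb Hl Hil Heq Hlt.
assert (Hell := ellipse_bound F s HF Hreal (Rlt_le _ _ Hs) Hg Hb).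
(* The phase for which the cosine has the value and the derivative of F at x. *)
destruct (exists_phase (Re (F (RtoC x))) (- Re l / s)) as (theta & Hcos & Hsin).
{ replace ((- Re l / s) ^ 2) with (Re l ^ 2 / s ^ 2) by (field; lra).
  apply (Rmult_eq_reg_l (s ^ 2)); [|apply pow_nonzero; lra]. field_simplify; lra. }
exists theta.
assert (Hsin0 : sin theta <> 0).
{ intros E. assert (K := sin2_cos2 theta). unfold Rsqr in K. rewrite E, Hcos in K.
  rewrite <- (pow2_abs (Re (F x))) in *. apply Rabs_def2 in Hlt. unfold Rabs in *. destruct Rcase_abs; nra. }
set (q := RtoC x) in *.
set (zeta := fun z => (RtoC s * z + RtoC (theta - s * x))%C).
assert (Hzq : zeta q = RtoC theta) by (unfold zeta, q; apply injective_projections; simpl; ring).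
assert (Hzparts : forall a b, zeta (a, b) = (s * (a - x) + theta, s * b)).
{ intros a b. unfold zeta. apply injective_projections; simpl; ring. }
assert (Hzd : forall z, cdiff zeta z) by (intros z; unfold zeta; prove_cdiff).
set (D := fun z => (F z - ccos (zeta z))%C).
assert (HD : entire D).
{ intros z. apply (cdiff_minus F (fun z => ccos (zeta z))); [apply HF|].
  apply (cdiff_comp ccos zeta); [apply ccos_cdiff|apply Hzd]. }
set (S := fun z => csin (zeta z)).
assert (HS : forall z, cdiff S z) by (intros z; apply (cdiff_comp csin zeta); [apply csin_cdiff|apply Hzd]).
assert (HSq : S q = RtoC (sin theta)).
{ unfold S. rewrite Hzq. unfold RtoC. rewrite csin_parts, cosh_0, sinh_0. f_equal; ring. }
assert (HDq : D q = RtoC 0).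
{ unfold D. rewrite Hzq. unfold RtoC. rewrite ccos_parts, cosh_0, sinh_0.
  specialize (Hreal x). fold q in Hreal. destruct (F q) as [f1 f2]. simpl in Hreal, Hcos.
  apply injective_projections; simpl; [rewrite Hcos|rewrite Hreal]; ring. }
assert (HD' : is_cderive D q (RtoC 0)).
{ assert (H1 : is_cderive (fun z => ccos (zeta z)) q l).
  { assert (H2 := is_cderive_comp ccos zeta q _ _ (is_cderive_cos (zeta q)) (is_cderive_linear (RtoC s) (RtoC (theta - s * x)) q)).
    replace l with (RtoC s * - csin (zeta q))%C; [exact H2|].
    fold (S q). rewrite HSq, Hsin. destruct l as [l1 l2]. simpl in Hil. subst l2.
    apply injective_projections; simpl; field; lra. }
  assert (H3 := is_derive_minus (K := C_AbsRing) (V := C_NormedModule) _ _ _ _ _ Hl H1).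
  rewrite (minus_eq_zero (G := NormedModule.AbelianGroup C_AbsRing C_NormedModule) l) in H3. exact H3. }
assert (Hmods : 0 < Cmod (S q)) by (rewrite HSq, Cmod_R; apply Rabs_pos_lt, Hsin0).
destruct (ccont_Cmod S q (cdiff_cont _ _ (HS q)) _ Hmods) as [d [Hd HSd]].
assert (HSnz : forall z, Cmod (z - q) < d -> S z <> RtoC 0).
{ intros z Hz. apply Cmod_gt_0. specialize (HSd z Hz). apply Rabs_def2 in HSd. lra. }
assert (HSq0 : S q <> RtoC 0) by (apply Cmod_gt_0, Hmods).
set (p := fun z => (D z / S z)%C).
assert (Hp : forall z, Cmod (z - q) < d -> p z = 0).
{ apply flat_nevanlinna_vanishes.
  - intros z Hz. apply cdiff_div; [apply HD|apply HS|apply HSnz, Hz].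
  - unfold p. fold q. rewrite HDq. unfold Cdiv. ring.
  - fold q. destruct (cdiff_inv S q (HS q) HSq0) as [k Hk].
    assert (K := is_cderive_mult _ _ _ _ _ HD' Hk). cbv beta in K. rewrite HDq in K.
    replace (RtoC 0) with (0 * / S q + 0 * k)%C by ring. exact K.
  - intros [a b] Hz. specialize (HSnz _ Hz).
    assert (Hm2 : 0 < Cmod (S (a, b)) ^ 2) by (apply pow_lt, Cmod_gt_0, HSnz).
    assert (Ep : Im (p (a, b)) * Cmod (S (a, b)) ^ 2 = Im (D (a, b)) * Re (S (a, b)) - Re (D (a, b)) * Im (S (a, b))).
    { unfold p. rewrite Cmod2_alt in *. destruct (S (a, b)) as [s1 s2], (D (a, b)) as [e1 e2]. simpl in Hm2 |- *.
      field. lra. }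
    apply (Rmult_le_reg_r (s * Cmod (S (a, b)) ^ 2)); [apply Rmult_lt_0_compat; assumption|].
    rewrite Rmult_0_l. change (Im (a, b)) with b.
    replace (b * Im (p (a, b)) * (s * Cmod (S (a, b)) ^ 2)) with (s * b * (Im (p (a, b)) * Cmod (S (a, b)) ^ 2)) by ring.
    rewrite Ep. unfold S, D. rewrite Hzparts, csin_parts, ccos_parts.
    assert (K := ellipse_support (Re (F (a, b))) (Im (F (a, b))) (s * (a - x) + theta) (s * b) (Hell a b)).
    simpl. unfold Re, Im in K. rewrite Ropp_involutive. exact K.
  - intros a _. unfold p, S, D. specialize (Hreal a). unfold RtoC in *. rewrite Hzparts, csin_parts, ccos_parts.
    rewrite Rmult_0_r, cosh_0, sinh_0. destruct (F (a, 0)) as [u v]. simpl in *. rewrite Hreal.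
    unfold Rdiv. ring. }
assert (HDzero : forall z, D z = 0).
{ apply (vanishing_near_point D q d HD Hd). intros z Hz.
  replace (D z) with (p z * S z)%C.
  - rewrite (Hp z Hz). apply Cmult_0_l.
  - unfold p. field. apply HSnz, Hz. }
intros t. specialize (HDzero (RtoC t)). unfold D in HDzero.
assert (E : F (RtoC t) = ccos (zeta (RtoC t))).
{ replace (F (RtoC t)) with ((F (RtoC t) - ccos (zeta (RtoC t))) + ccos (zeta (RtoC t)))%C by ring. rewrite HDzero. ring. }
rewrite E. unfold RtoC. rewrite Hzparts, ccos_parts, Rmult_0_r, cosh_0. simpl. ring.
Qed.

(** * The inequality for functions of exponential type *)

Definition unit_scaled (M : R) (F : C -> C) (z : C) : C := (RtoC (/ M) * F z)%C.

Lemma Re_unit_scaled M F z : Re (unit_scaled M F z) = Re (F z) / M.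
Proof. unfold unit_scaled. destruct (F z). simpl. unfold Rdiv. ring. Qed.

Lemma unit_scaled_spec F s M : entire F -> real_on_R F -> 0 < M ->
  (forall eps, 0 < eps -> growth_le (s + eps) F) -> (forall t, Cmod (F (RtoC t)) <= M) ->
  entire (unit_scaled M F) /\ real_on_R (unit_scaled M F) /\
  (forall eps, 0 < eps -> growth_le (s + eps) (unit_scaled M F)) /\
  (forall t, Cmod (unit_scaled M F (RtoC t)) <= 1).
Proof.
intros HF Hreal HM Hg Hb. assert (HMi : 0 < / M) by (apply Rinv_0_lt_compat; assumption).
assert (Hmod : forall z, Cmod (unit_scaled M F z) = / M * Cmod (F z)).
{ intros z. unfold unit_scaled. rewrite Cmod_mult, Cmod_R, Rabs_pos_eq; lra. }
split; [|split; [|split]].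
- intros z. apply (cdiff_mult (fun _ => RtoC (/ M)) F); [apply cdiff_const|apply HF].
- intros t. specialize (Hreal t). unfold unit_scaled. destruct (F (RtoC t)). simpl in *. rewrite Hreal. ring.
- intros eps He. destruct (Hg eps He) as [K HK]. exists (/ M * K). intros z. rewrite Hmod, Rmult_assoc.
  apply Rmult_le_compat_l; [lra|apply HK].
- intros t. rewrite Hmod. specialize (Hb t). apply (Rmult_le_reg_l M); [assumption|].
  rewrite <- Rmult_assoc, Rinv_r; lra.
Qed.

Theorem bernstein_szego F s M x l : entire F -> real_on_R F -> 0 < s -> 0 < M ->
  (forall eps, 0 < eps -> growth_le (s + eps) F) -> (forall t, Cmod (F (RtoC t)) <= M) ->
  is_cderive F (RtoC x) l -> Re l ^ 2 + s ^ 2 * Re (F (RtoC x)) ^ 2 <= s ^ 2 * M ^ 2.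
Proof.
intros HF Hreal Hs HM Hg Hb Hl.
destruct (unit_scaled_spec F s M) as (H1 & H2 & H3 & H4); try assumption.
assert (H5 : is_cderive (unit_scaled M F) (RtoC x) (RtoC (/ M) * l)%C) by apply is_cderive_scal, Hl.
assert (B := bernstein_szego_unit _ s x _ H1 H2 (Rlt_le _ _ Hs) H3 H4 H5).
rewrite Re_unit_scaled in B. replace (Re (RtoC (/ M) * l)%C) with (Re l / M) in B by (destruct l; simpl; unfold Rdiv; ring).
apply (Rmult_le_compat_r (M ^ 2)) in B; [|apply pow2_ge_0].
replace (((Re l / M) ^ 2 + s ^ 2 * (Re (F x) / M) ^ 2) * M ^ 2) with (Re l ^ 2 + s ^ 2 * Re (F x) ^ 2) in B by (field; lra).
exact B.
Qed.

Theorem bernstein_szego_equality F s M x l : entire F -> real_on_R F -> 0 < s -> 0 < M ->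
  (forall eps, 0 < eps -> growth_le (s + eps) F) -> (forall t, Cmod (F (RtoC t)) <= M) ->
  is_cderive F (RtoC x) l -> Im l = 0 -> Re l ^ 2 + s ^ 2 * Re (F (RtoC x)) ^ 2 = s ^ 2 * M ^ 2 ->
  Rabs (Re (F (RtoC x))) < M ->
  exists theta, forall t, Re (F (RtoC t)) = M * cos (s * (t - x) + theta).
Proof.
intros HF Hreal Hs HM Hg Hb Hl Hil Heq Hlt.
destruct (unit_scaled_spec F s M) as (H1 & H2 & H3 & H4); try assumption.
assert (H5 : is_cderive (unit_scaled M F) (RtoC x) (RtoC (/ M) * l)%C) by apply is_cderive_scal, Hl.
assert (El : Re (RtoC (/ M) * l)%C = Re l / M) by (destruct l; simpl; unfold Rdiv; ring).
destruct (bernstein_szego_equality_unit _ s x _ H1 H2 Hs H3 H4 H5) as [theta Hth].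
- destruct l as [l1 l2]. simpl in *. rewrite Hil. ring.
- rewrite Re_unit_scaled, El. replace ((Re l / M) ^ 2 + s ^ 2 * (Re (F x) / M) ^ 2) with ((Re l ^ 2 + s ^ 2 * Re (F x) ^ 2) / M ^ 2) by (field; lra).
  rewrite Heq. field. lra.
- rewrite Re_unit_scaled. unfold Rdiv. rewrite Rabs_mult, (Rabs_pos_eq (/ M)) by (apply Rlt_le, Rinv_0_lt_compat; assumption).
  apply Rlt_div_l; lra.
- exists theta. intros t. rewrite <- Hth, Re_unit_scaled. field. lra.
Qed.

(** The upper limit bounds the weighted modulus outside some disc, and continuity bounds it inside. *)
Lemma exp_type_growth g f : 0 <= g -> exp_type_le g f -> entire f /\ forall eps, 0 < eps -> growth_le (g + eps) f.
Proof.
intros Hg0 [Hf H]. split; [assumption|]. intros eps He. specialize (H eps He).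
set (w := fun z => Cmod (f z) * exp (- (g + eps) * Cmod z)) in *.
unfold limsup_at_infinity in H.
set (E := fun v : Rbar => exists r : R, v = Lub_Rbar (fun y : R => exists z : C, r < Cmod z /\ y = w z)) in *.
assert (Hex : exists r B, forall z, r < Cmod z -> w z <= B).
{ apply NNPP. intros Hn. apply (Rbar_lt_not_le _ _ H).
  unfold Rbar_glb. destruct (Rbar_ex_glb E) as [v [Hv1 Hv]]. apply (Hv p_infty). intros u [r Hr].
  destruct u as [u| |]; simpl; try trivial; apply Hn.
  - exists r, u. intros z Hz.
    assert (L := proj1 (Lub_Rbar_correct (fun y : R => exists z : C, r < Cmod z /\ y = w z)) (w z)).
    rewrite <- Hr in L. apply L. exists z; auto.
  - exists r, 0. intros z Hz.
    assert (L := proj1 (Lub_Rbar_correct (fun y : R => exists z : C, r < Cmod z /\ y = w z)) (w z)).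
    rewrite <- Hr in L. exfalso. apply L. exists z; auto. }
destruct Hex as (r & B & HB).
destruct (bounded_on_rectangle f (- r) r (- r) r Hf) as [B2 [HB2 HB3]].
exists (Rabs B + B2). intros z.
assert (He1 : 1 <= exp ((g + eps) * Cmod z)).
{ rewrite <- exp_0. apply exp_le, Rmult_le_pos; [lra|apply Cmod_ge_0]. }
assert (HaB := Rle_abs B). assert (HaB0 := Rabs_pos B).
destruct (Rlt_le_dec r (Cmod z)) as [L|L].
- specialize (HB z L). unfold w in HB.
  replace (- (g + eps) * Cmod z) with (- ((g + eps) * Cmod z)) in HB by ring.
  apply le_exp_transfer in HB. nra.
- assert (K1 := re_le_Cmod z). assert (K2 := im_le_Cmod z).
  assert (Cmod (f z) <= B2).
  { apply HB3; apply Rabs_le_between; lra. }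
  nra.
Qed.

Lemma growth_le_mult a b f g : growth_le a f -> growth_le b g -> growth_le (a + b) (fun z => f z * g z)%C.
Proof.
intros [K HK] [L HL]. exists (K * L). intros z. rewrite Cmod_mult.
replace (K * L * exp ((a + b) * Cmod z)) with ((K * exp (a * Cmod z)) * (L * exp (b * Cmod z))).
- apply Rmult_le_compat; try apply Cmod_ge_0; auto.
- rewrite Rmult_plus_distr_r, exp_plus. ring.
Qed.

Lemma real_derivative f t l : is_cderive f (RtoC t) l ->
  is_derive (fun u => Re (f (RtoC u))) t (Re l) /\ is_derive (fun u => Im (f (RtoC u))) t (Im l).
Proof.
intros H. rewrite is_cderive_eps in H.
assert (K : forall eps, 0 < eps -> exists delta : posreal, forall h, h <> 0 -> Rabs h < delta ->
  Cmod (f (RtoC (t + h)) - f (RtoC t) - RtoC h * l)%C < eps * Rabs h).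
{ intros eps He. destruct (H (eps / 2)) as [d [Hd HD]]; [lra|]. exists (mkposreal d Hd). simpl. intros h Hh Hlt.
  assert (E : (RtoC (t + h) - RtoC t)%C = RtoC h) by (apply injective_projections; simpl; ring).
  specialize (HD (RtoC (t + h))). rewrite E, Cmod_R in HD. specialize (HD Hlt).
  assert (0 < Rabs h) by (apply Rabs_pos_lt, Hh). nra. }
split; apply is_derive_Reals; intros eps He; destruct (K eps He) as [d HD]; exists d; intros h Hh Hlt;
specialize (HD h Hh Hlt); assert (P : 0 < Rabs h) by (apply Rabs_pos_lt, Hh);
set (w := f (RtoC (t + h))) in *; set (w0 := f (RtoC t)) in *.
- replace ((Re w - Re w0) / h - Re l) with (Re (w - w0 - RtoC h * l)%C / h) by (simpl; unfold Re; field; assumption).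
  unfold Rdiv. rewrite Rabs_mult, Rabs_inv. apply Rlt_div_l; [assumption|].
  eapply Rle_lt_trans; [apply re_le_Cmod|assumption].
- replace ((Im w - Im w0) / h - Im l) with (Im (w - w0 - RtoC h * l)%C / h) by (simpl; unfold Im; field; assumption).
  unfold Rdiv. rewrite Rabs_mult, Rabs_inv. apply Rlt_div_l; [assumption|].
  eapply Rle_lt_trans; [apply im_le_Cmod|assumption].
Qed.

Lemma derivative_real f t l : real_on_R f -> is_cderive f (RtoC t) l -> Im l = 0.
Proof.
intros Hr H. destruct (real_derivative f t l H) as [_ K].
apply is_derive_unique in K. rewrite <- K.
rewrite (Derive_ext _ (fun _ => 0)) by exact Hr. apply Derive_const.
Qed.

(** * The comparison argument and the theorem *)

Lemma derive_zero_at_max (h : R -> R) a b c d : a < c < b -> is_derive h c d ->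
  (forall x, a < x < b -> h x <= h c) -> d = 0.
Proof.
intros Hc Hd Hmax.
assert (pr : derivable_pt h c) by (exists d; apply is_derive_Reals, Hd).
assert (E : derive_pt h c pr = d) by (apply derive_pt_eq, is_derive_Reals, Hd).
rewrite <- E. apply (deriv_maximum h a b); try lra. intros x Hxa Hxb. apply Hmax; lra.
Qed.

(** Here Q h plays the role of F and M bounds its sup norm.  A point where h is at least H = h(x1) cannot
    be critical, so h stays at least H to the right or to the left of x1.  On this half-line 1/h stays
    in (0, 1/H] and thus has a derivative of size at most t/H at some point within distance 1/t of x1;
    at that point Q = (Q h) (1/h) gives A H^2 <= s^2 M^2 + O(t). *)
Lemma comparison (Q h dQ dh : R -> R) (s M A : R) :
  (forall t, is_derive Q t (dQ t)) -> (forall t, is_derive h t (dh t)) ->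
  0 < s -> 0 < M -> 0 <= A ->
  (forall t, A <= dQ t ^ 2 + s ^ 2 * Q t ^ 2) ->
  (forall t, (dQ t * h t + Q t * dh t) ^ 2 + s ^ 2 * (Q t * h t) ^ 2 <= s ^ 2 * M ^ 2) ->
  forall x, 0 < h x -> A * h x ^ 2 <= s ^ 2 * M ^ 2.
Proof.
intros HQ Hh Hs HM HA HAt HB x1 Hpos. apply Rnot_lt_le. intros Hlt.
set (H := h x1) in *.
(* At a critical point the derivative of Q h is Q' h. *)
assert (Hcrit : forall t, H <= h t -> dh t <> 0).
{ intros t Ht E. specialize (HB t). rewrite E in HB. specialize (HAt t).
  assert (H ^ 2 <= h t ^ 2) by (apply pow_incr; lra).
  assert (A * H ^ 2 <= A * h t ^ 2) by (apply Rmult_le_compat_l; assumption).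
  assert (0 <= h t ^ 2) by apply pow2_ge_0.
  assert (A * h t ^ 2 <= (dQ t ^ 2 + s ^ 2 * Q t ^ 2) * h t ^ 2) by (apply Rmult_le_compat_r; assumption).
  replace ((dQ t * h t + Q t * 0) ^ 2 + s ^ 2 * (Q t * h t) ^ 2) with ((dQ t ^ 2 + s ^ 2 * Q t ^ 2) * h t ^ 2) in HB by ring.
  lra. }
assert (Hcont : forall t, continuity_pt h t).
{ intros t. apply derivable_continuous_pt. exists (dh t). apply is_derive_Reals, Hh. }
assert (Hside : exists e, (e = 1 \/ e = -1) /\ forall t, 0 <= t -> H <= h (x1 + e * t)).
{ destruct (classic (forall t, 0 <= t -> H <= h (x1 + 1 * t))) as [H1|H1]; [exists 1; auto|].
  destruct (classic (forall t, 0 <= t -> H <= h (x1 + -1 * t))) as [H2|H2]; [exists (-1); auto|].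
  exfalso. apply not_all_ex_not in H1, H2. destruct H1 as [t1 H1], H2 as [t2 H2].
  apply imply_to_and in H1, H2. destruct H1 as [P1 N1], H2 as [P2 N2]. apply Rnot_le_lt in N1, N2.
  assert (T1 : 0 < t1). { destruct P1 as [P1|P1]; [exact P1|exfalso]. rewrite <- P1, Rmult_0_r, Rplus_0_r in N1. unfold H in N1; lra. }
  assert (T2 : 0 < t2). { destruct P2 as [P2|P2]; [exact P2|exfalso]. rewrite <- P2, Rmult_0_r, Rplus_0_r in N2. unfold H in N2; lra. }
  destruct (continuity_ab_maj h (x1 + -1 * t2) (x1 + 1 * t1)) as [c [Hc1 Hc2]]; [lra|intros; apply Hcont|].
  assert (Hc : H <= h c) by (apply Hc1; lra).
  assert (Hin : x1 + -1 * t2 < c < x1 + 1 * t1).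
  { destruct Hc2 as [[L1|L1] [L2|L2]]; try lra; exfalso; subst c; lra. }
  apply (Hcrit c Hc). apply (derive_zero_at_max h (x1 + -1 * t2) (x1 + 1 * t1) c); [assumption|apply Hh|].
  intros y Hy. apply Hc1; lra. }
destruct Hside as (e & He & Hside).
assert (Lim : forall t, 0 < t < 1 -> A * H ^ 2 <= s ^ 2 * M ^ 2 + 2 * s * M ^ 2 * t + M ^ 2 * t ^ 2).
{ intros t [Ht0 Ht1].
  assert (HN : 0 < / t) by (apply Rinv_0_lt_compat; assumption).
  assert (Hbetween : forall u, Rmin x1 (x1 + e * / t) <= u <= Rmax x1 (x1 + e * / t) -> H <= h u).
  { intros u Hu. destruct He as [->| ->].
    - rewrite Rmin_left, Rmax_right in Hu by lra. replace u with (x1 + 1 * (u - x1)) by ring. apply Hside; lra.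
    - rewrite Rmin_right, Rmax_left in Hu by lra. replace u with (x1 + -1 * (x1 - u)) by ring. apply Hside; lra. }
  assert (Hdg : forall u, Rmin x1 (x1 + e * / t) <= u <= Rmax x1 (x1 + e * / t) -> is_derive (fun y => / h y) u (- dh u / h u ^ 2)).
  { intros u Hu. specialize (Hbetween u Hu). apply is_derive_inv; [apply Hh|lra]. }
  destruct (MVT_gen (fun y => / h y) x1 (x1 + e * / t) (fun u => - dh u / h u ^ 2)) as (xi & Hxi & E).
  - intros u Hu. apply Hdg. lra.
  - intros u Hu. apply derivable_continuous_pt. eexists. apply is_derive_Reals, Hdg, Hu.
  - assert (Hend : H <= h (x1 + e * / t)) by (apply Hside; lra). fold H in E.
    assert (Hxih := Hbetween xi Hxi). specialize (HAt xi). specialize (HB xi).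
    set (hx := h xi) in *. set (g := / hx).
    assert (Hg : 0 < g <= / H) by (unfold g; split; [apply Rinv_0_lt_compat; lra|apply Rinv_le_contravar; lra]).
    set (g' := - dh xi / hx ^ 2) in *.
    assert (Hg' : H * Rabs g' <= t).
    { assert (I1 : 0 < / h (x1 + e * / t) <= / H) by (split; [apply Rinv_0_lt_compat; lra|apply Rinv_le_contravar; lra]).
      assert (Eabs : Rabs (/ h (x1 + e * / t) - / H) = Rabs g' * / t).
      { rewrite E. replace (g' * (x1 + e * / t - x1)) with (g' * (e * / t)) by ring. rewrite !Rabs_mult.
        rewrite (Rabs_pos_eq (/ t)) by lra. destruct He as [->| ->]; [rewrite Rabs_R1|rewrite (Rabs_left (-1)) by lra]; ring. }
      assert (Rabs (/ h (x1 + e * / t) - / H) <= / H) by (apply Rabs_le; lra).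
      rewrite Eabs in H0. apply Rle_div_l in H0; [|assumption].
      apply (Rmult_le_compat_l H) in H0; [|lra]. rewrite <- Rmult_assoc, Rinv_r in H0 by lra. lra. }
    (* With a = H/h and b = H (1/h)' the bound on A follows from H Q = P a and H Q' = P' a + P b. *)
    set (P := Q xi * hx) in *. set (dP := dQ xi * hx + Q xi * dh xi) in *.
    assert (EQ : Q xi = P * g) by (unfold P, g; field; lra).
    assert (EdQ : dQ xi = dP * g + P * g') by (unfold P, dP, g, g'; field; lra).
    assert (HP : Rabs P <= M).
    { rewrite <- (Rabs_pos_eq M) by lra. apply Rsqr_le_abs_0. unfold Rsqr.
      assert (0 <= dP ^ 2) by apply pow2_ge_0. assert (0 < s ^ 2) by (apply pow_lt; assumption). nra. }
    assert (HdP : Rabs dP <= s * M).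
    { rewrite <- (Rabs_pos_eq (s * M)) by nra. apply Rsqr_le_abs_0. unfold Rsqr.
      assert (0 <= P ^ 2) by apply pow2_ge_0. assert (0 < s ^ 2) by (apply pow_lt; assumption). nra. }
    rewrite EQ, EdQ in HAt.
    set (a := H * g) in *.
    assert (Ha : 0 <= a <= 1).
    { unfold a. split; [nra|]. destruct Hg as [_ Hg2]. apply (Rmult_le_compat_l H) in Hg2; [|lra]. rewrite Rinv_r in Hg2; lra. }
    set (b := H * g').
    assert (Hb : Rabs b <= t) by (unfold b; rewrite Rabs_mult, (Rabs_pos_eq H); lra).
    assert (Hmul : A * H ^ 2 <= (dP * a + P * b) ^ 2 + s ^ 2 * (P * a) ^ 2).
    { apply (Rmult_le_compat_r (H ^ 2)) in HAt; [|apply pow2_ge_0]. unfold a, b.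
      eapply Rle_trans; [exact HAt|]. apply Req_le. ring. }
    eapply Rle_trans; [exact Hmul|].
    replace ((dP * a + P * b) ^ 2 + s ^ 2 * (P * a) ^ 2) with
      (a ^ 2 * (dP ^ 2 + s ^ 2 * P ^ 2) + 2 * (a * (dP * P * b)) + (P * b) ^ 2) by ring.
    assert (Hpb : Rabs (P * b) <= M * t) by (rewrite Rabs_mult; apply Rmult_le_compat; try apply Rabs_pos; assumption).
    assert (X1 : a ^ 2 * (dP ^ 2 + s ^ 2 * P ^ 2) <= s ^ 2 * M ^ 2).
    { assert (0 <= a ^ 2 <= 1) by (split; [apply pow2_ge_0|nra]).
      assert (0 <= s ^ 2 * M ^ 2) by (apply Rmult_le_pos; apply pow2_ge_0).
      assert (0 <= dP ^ 2 + s ^ 2 * P ^ 2) by (assert (0 <= dP ^ 2) by apply pow2_ge_0; assert (0 <= s ^ 2 * P ^ 2) by (apply Rmult_le_pos; apply pow2_ge_0); lra).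
      nra. }
    assert (X2 : a * (dP * P * b) <= s * M ^ 2 * t).
    { assert (Y : dP * P * b <= s * M * (M * t)).
      { eapply Rle_trans; [apply Rle_abs|]. rewrite Rmult_assoc, Rabs_mult. apply Rmult_le_compat; try apply Rabs_pos; assumption. }
      assert (0 <= s * M * (M * t)) by (repeat apply Rmult_le_pos; lra).
      replace (s * M ^ 2 * t) with (s * M * (M * t)) by ring. nra. }
    assert (X3 : (P * b) ^ 2 <= M ^ 2 * t ^ 2).
    { rewrite <- (pow2_abs (P * b)). replace (M ^ 2 * t ^ 2) with ((M * t) ^ 2) by ring. apply pow_incr. split; [apply Rabs_pos|assumption]. }
    lra. }
assert (L := le_limit_right (fun t => s ^ 2 * M ^ 2 + 2 * s * M ^ 2 * t + M ^ 2 * t ^ 2) (A * H ^ 2) 1 Rlt_0_1).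
cbv beta in L. specialize (L ltac:(auto_derive; auto) Lim).
replace (s ^ 2 * M ^ 2 + 2 * s * M ^ 2 * 0 + M ^ 2 * 0 ^ 2) with (s ^ 2 * M ^ 2) in L by ring. lra.
Qed.

Lemma A_inf_spec s Q : 0 <= A_inf s Q /\ forall t : R,
  A_inf s Q <= Re (C_derive Q (RtoC t)) ^ 2 + s ^ 2 * Re (Q (RtoC t)) ^ 2.
Proof.
unfold A_inf. set (E := fun y : R => exists t : R, y = Re (C_derive Q (RtoC t)) ^ 2 + s ^ 2 * Re (Q (RtoC t)) ^ 2).
destruct (Glb_Rbar_correct E) as [H1 H2].
assert (H0 : Rbar_le 0 (Glb_Rbar E)).
{ apply H2. intros y [t ->]. simpl.
  assert (A1 := pow2_ge_0 (Re (C_derive Q (RtoC t)))). assert (A2 := pow2_ge_0 (s * Re (Q (RtoC t)))).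
  replace (s ^ 2 * Re (Q (RtoC t)) ^ 2) with ((s * Re (Q (RtoC t))) ^ 2) by ring. simpl in *; lra. }
assert (Ht : forall t : R, Rbar_le (Glb_Rbar E) (Re (C_derive Q (RtoC t)) ^ 2 + s ^ 2 * Re (Q (RtoC t)) ^ 2)).
{ intros t. apply H1. exists t. reflexivity. }
destruct (Glb_Rbar E) as [v| |]; simpl in *.
- split; assumption.
- exfalso. apply (Ht 0).
- contradiction.
Qed.

Lemma sup_norm_spec g : match sup_norm_R g with
  | Finite M => 0 <= M /\ forall t : R, Cmod (g (RtoC t)) <= M
  | p_infty => True | m_infty => False end.
Proof.
unfold sup_norm_R. set (E := fun y : R => exists t : R, y = Cmod (g (RtoC t))).
destruct (Lub_Rbar_correct E) as [H1 _].
assert (Ht : forall t : R, Rbar_le (Cmod (g (RtoC t))) (Lub_Rbar E)).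
{ intros t. apply H1. exists t. reflexivity. }
destruct (Lub_Rbar E) as [v| |]; simpl in *; trivial.
- split; [|exact Ht]. eapply Rle_trans; [|apply (Ht 0)]. apply Cmod_ge_0.
- apply (Ht 0).
Qed.

Lemma product_growth tau sigma Q f : 0 <= tau -> 0 < sigma -> exp_type_le tau Q -> exp_type_le sigma f ->
  entire (fun z => Q z * f z)%C /\ forall eps, 0 < eps -> growth_le (sigma + tau + eps) (fun z => Q z * f z)%C.
Proof.
intros htau hsigma hQ Hf. destruct (exp_type_growth tau Q htau hQ) as [Q1 Q2].
destruct (exp_type_growth sigma f (Rlt_le _ _ hsigma) Hf) as [f1 f2]. split.
- intros z. apply (cdiff_mult Q f); [apply Q1|apply f1].
- intros eps He. replace (sigma + tau + eps) with ((tau + eps / 2) + (sigma + eps / 2)) by field.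
  apply growth_le_mult; [apply Q2|apply f2]; lra.
Qed.

Lemma entire_C_derive f z : entire f -> is_cderive f z (C_derive f z).
Proof. intros Hf. apply C_derive_correct; [exact (RtoC 0)|apply Hf]. Qed.

(** The inequality of Bernstein and Szego needs a function that is real on the line.  With c the
    conjugate phase of f(x), the function G is the entire extension of Re (c Q f) from the line, and
    [comparison] applies to h = Re (c f), which equals |f| at x. *)
Lemma pointwise_bound tau sigma Q f M x : 0 <= tau -> 0 < sigma -> exp_type_le tau Q -> real_on_R Q ->
  exp_type_le sigma f -> 0 < M ->
  (forall t, Cmod (Q (RtoC t) * f (RtoC t))%C <= M) ->
  A_inf (sigma + tau) Q * Cmod (f (RtoC x)) ^ 2 <= (sigma + tau) ^ 2 * M ^ 2.
Proof.
intros htau hsigma hQ hQreal Hf HM Hb. set (s := sigma + tau) in *.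
assert (Hs : 0 < s) by (unfold s; lra).
destruct (A_inf_spec s Q) as [HA HAt].
destruct (product_growth tau sigma Q f htau hsigma hQ Hf) as [Hent Hgr]. fold s in Hgr.
assert (HQe : entire Q) by apply hQ. assert (Hfe : entire f) by apply Hf.
destruct (Req_dec (Cmod (f (RtoC x))) 0) as [E|E].
{ rewrite E. replace (A_inf s Q * 0 ^ 2) with 0 by ring. apply Rmult_le_pos; apply pow2_ge_0. }
assert (Hfx : 0 < Cmod (f (RtoC x))) by (generalize (Cmod_ge_0 (f (RtoC x))); lra).
set (c := (Cconj (f (RtoC x)) * RtoC (/ Cmod (f (RtoC x))))%C).
assert (Hc : Cmod c = 1).
{ unfold c. rewrite Cmod_mult, Cmod_conj, Cmod_R, Rabs_pos_eq; [field; lra|]. apply Rlt_le, Rinv_0_lt_compat, Hfx. }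
set (h := fun t => Re (c * f (RtoC t))%C).
assert (Hhx : h x = Cmod (f (RtoC x))).
{ unfold h, c. replace (Re (Cconj (f (RtoC x)) * RtoC (/ Cmod (f (RtoC x))) * f (RtoC x))%C)
    with ((Re (f (RtoC x)) ^ 2 + Im (f (RtoC x)) ^ 2) * / Cmod (f (RtoC x))).
  - rewrite <- Cmod2_alt. field. lra.
  - destruct (f (RtoC x)). simpl. ring. }
set (F := fun z => (c * (Q z * f z))%C).
assert (HF : entire F) by (intros z; apply (cdiff_mult (fun _ => c) (fun z => Q z * f z)%C); [apply cdiff_const|apply Hent]).
set (G := fun z => (RtoC (/ 2) * (F z + Cconj (F (Cconj z))))%C).
assert (HG : entire G).
{ intros z. apply (cdiff_mult (fun _ => RtoC (/ 2))); [apply cdiff_const|].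
  apply (cdiff_plus F (fun z => Cconj (F (Cconj z)))); [apply HF|apply cdiff_conj, HF]. }
assert (Hcr : forall t : R, Cconj (RtoC t) = RtoC t) by (intros t; apply injective_projections; simpl; ring).
assert (HGR : forall t : R, G (RtoC t) = RtoC (Re (F (RtoC t)))).
{ intros t. unfold G. rewrite Hcr. destruct (F (RtoC t)). apply injective_projections; simpl; field. }
assert (HFh : forall t : R, Re (F (RtoC t)) = Re (Q (RtoC t)) * h t).
{ intros t. unfold F, h. specialize (hQreal t). destruct (Q (RtoC t)), (f (RtoC t)), c. simpl in *. rewrite hQreal. ring. }
assert (HGb : forall t, Cmod (G (RtoC t)) <= M).
{ intros t. rewrite HGR, Cmod_R. eapply Rle_trans; [apply re_le_Cmod|]. unfold F. rewrite Cmod_mult, Hc, Rmult_1_l. apply Hb. }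
assert (HGreal : real_on_R G) by (intros t; rewrite HGR; reflexivity).
assert (HGg : forall eps, 0 < eps -> growth_le (s + eps) G).
{ intros eps He. destruct (Hgr eps He) as [K HK]. exists K. intros z.
  assert (HFz : forall w, Cmod (F w) <= K * exp ((s + eps) * Cmod w)).
  { intros w. unfold F. rewrite Cmod_mult, Hc, Rmult_1_l. apply HK. }
  unfold G. rewrite Cmod_mult, Cmod_R, Rabs_pos_eq by lra.
  assert (Ht := Cmod_triangle (F z) (Cconj (F (Cconj z)))). rewrite Cmod_conj in Ht.
  assert (K1 := HFz z). assert (K2 := HFz (Cconj z)). rewrite Cmod_conj in K2. lra. }
rewrite <- Hhx.
apply (comparison (fun t => Re (Q (RtoC t))) h (fun t => Re (C_derive Q (RtoC t))) (fun t => Re (c * C_derive f (RtoC t))%C) s M).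
- intros t. apply (real_derivative Q), entire_C_derive, HQe.
- intros t. apply (real_derivative (fun z => c * f z)%C). apply is_cderive_scal, entire_C_derive, Hfe.
- assumption.
- assumption.
- assumption.
- exact HAt.
- intros t. destruct (HG (RtoC t)) as [l Hl].
  assert (B := bernstein_szego G s M t l HG HGreal Hs HM HGg HGb Hl).
  assert (El : Re l = Re (C_derive Q (RtoC t)) * h t + Re (Q (RtoC t)) * Re (c * C_derive f (RtoC t))%C).
  { destruct (real_derivative G t l Hl) as [K _]. apply is_derive_unique in K. rewrite <- K.
    rewrite (Derive_ext _ (fun u => Re (Q (RtoC u)) * h u)) by (intros u; rewrite HGR; apply HFh).
    apply is_derive_unique. apply Derive.is_derive_mult.
    - apply (real_derivative Q), entire_C_derive, HQe.
    - apply (real_derivative (fun z => c * f z)%C). apply is_cderive_scal, entire_C_derive, Hfe. }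
  rewrite El, HGR in B. simpl Re in B at 4. rewrite <- HFh. exact B.
- rewrite Hhx. assumption.
Qed.

Lemma pointwise_bound_sqrt tau sigma Q f M x : 0 <= tau -> 0 < sigma -> exp_type_le tau Q -> real_on_R Q ->
  exp_type_le sigma f -> 0 <= M -> 0 < A_inf (sigma + tau) Q ->
  (forall t, Cmod (Q (RtoC t) * f (RtoC t))%C <= M) ->
  Cmod (f (RtoC x)) <= (sigma + tau) * / sqrt (A_inf (sigma + tau) Q) * M.
Proof.
intros htau hsigma hQ hQreal Hf HM HA Hb. set (s := sigma + tau) in *. set (A := A_inf s Q) in *.
assert (Hs : 0 < s) by (unfold s; lra).
assert (Hq : 0 < sqrt A) by (apply sqrt_lt_R0; assumption).
assert (L := le_limit_right (fun e => s * / sqrt A * (M + e)) (Cmod (f (RtoC x))) 1 Rlt_0_1).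
cbv beta in L. rewrite Rplus_0_r in L. apply L; [auto_derive; auto|]. intros e [He _].
assert (B := pointwise_bound tau sigma Q f (M + e) x htau hsigma hQ hQreal Hf ltac:(lra)). fold s A in B.
assert (B' : A * Cmod (f (RtoC x)) ^ 2 <= s ^ 2 * (M + e) ^ 2).
{ apply B. intros t. specialize (Hb t). lra. }
rewrite <- (sqrt_sqrt A) in B' by lra.
apply (Rmult_le_reg_l (sqrt A)); [assumption|].
replace (sqrt A * (s * / sqrt A * (M + e))) with (s * (M + e)) by (field; lra).
apply Rsqr_incr_0_var; [unfold Rsqr|nra]. nra.
Qed.

Theorem theorem1p1 (tau sigma : R) (Q : C -> C)
  (htau : 0 <= tau) (hsigma : 0 < sigma)
  (hQ : exp_type_le tau Q) (hQreal : real_on_R Q)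
  (hsep : separated_real_zeros Q) :
  (forall f : C -> C, exp_type_le sigma f ->
     forall x : R,
       Rbar_le (Finite (Cmod (f (RtoC x)))) (bound_rhs (sigma + tau) Q f))
  /\
  (forall (f : C -> C) (x0 : R),
     exp_type_le sigma f -> real_on_R f -> not_identically_zero f ->
     Finite (Cmod (f (RtoC x0))) = bound_rhs (sigma + tau) Q f ->
     Finite (Cmod (Cmult (Q (RtoC x0)) (f (RtoC x0))))
       = sup_norm_R (fun z => Cmult (Q z) (f z))
     \/
     exists S K : R,
       0 < Rabs S + Rabs K /\
       forall x : R,
         Cmult (Q (RtoC x)) (f (RtoC x)) =
         RtoC (S * sin ((sigma + tau) * x) + K * cos ((sigma + tau) * x))).
Proof.
set (s := sigma + tau).
assert (Hs : 0 < s) by (unfold s; lra).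
destruct (A_inf_spec s Q) as [HA HAt].
assert (Hcoef : A_inf s Q <> 0 -> 0 < s * / sqrt (A_inf s Q)).
{ intros Hn. apply Rmult_lt_0_compat; [assumption|]. apply Rinv_0_lt_compat, sqrt_lt_R0. lra. }
assert (Hinf : forall k, 0 < k -> Rbar_mult (Finite k) p_infty = p_infty).
{ intros k Hk. apply is_Rbar_mult_unique, is_Rbar_mult_sym, is_Rbar_mult_p_infty_pos. exact Hk. }
split.
- intros f Hf x. unfold bound_rhs. destruct (Req_EM_T (A_inf s Q) 0) as [E|E]; [exact I|].
  assert (S := sup_norm_spec (fun z => Q z * f z)%C).
  destruct (sup_norm_R (fun z => Q z * f z)%C) as [M| |]; [|rewrite Hinf by auto; exact I|contradiction].
  destruct S as [HM Hb]. simpl. apply pointwise_bound_sqrt; try assumption. fold s. lra.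
- intros f x0 Hf Hfreal _. unfold bound_rhs. destruct (Req_EM_T (A_inf s Q) 0) as [E|E]; [discriminate|].
  assert (S := sup_norm_spec (fun z => Q z * f z)%C).
  destruct (sup_norm_R (fun z => Q z * f z)%C) as [M| |]; [|rewrite Hinf by auto; discriminate|contradiction].
  destruct S as [HM Hb]. intros Heq. apply Rbar_finite_eq in Heq.
  assert (HApos : 0 < A_inf s Q) by lra.
  assert (Hq : 0 < sqrt (A_inf s Q)) by (apply sqrt_lt_R0; assumption).
  destruct (Rle_lt_or_eq_dec _ _ (Hb x0)) as [Hlt|Hmax]; [right|left; rewrite Hmax; reflexivity].
  assert (HM0 : 0 < M) by (eapply Rle_lt_trans; [apply Cmod_ge_0|exact Hlt]).
  assert (HQe : entire Q) by apply hQ. assert (Hfe : entire f) by apply Hf.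
  (* By the first part |f| is largest at x0. *)
  set (h := fun t => Re (f (RtoC t))).
  assert (Hmod : forall t, Cmod (f (RtoC t)) ^ 2 = h t ^ 2).
  { intros t. rewrite Cmod2_alt, Hfreal. unfold h. ring. }
  assert (Hhmax : forall t, h t ^ 2 <= h x0 ^ 2).
  { intros t. rewrite <- !Hmod. apply pow_incr. split; [apply Cmod_ge_0|]. rewrite Heq.
    apply pointwise_bound_sqrt; assumption. }
  assert (Hh0 : h x0 <> 0).
  { intros K. assert (Z := Hmod x0). rewrite K, Heq in Z. specialize (Hcoef E).
    assert (0 < s * / sqrt (A_inf s Q) * M) by (apply Rmult_lt_0_compat; assumption). nra. }
  set (dQ := C_derive Q (RtoC x0)). set (df := C_derive f (RtoC x0)).
  assert (HdQ : is_cderive Q (RtoC x0) dQ) by (apply entire_C_derive, HQe).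
  assert (Hdf : is_cderive f (RtoC x0) df) by (apply entire_C_derive, Hfe).
  assert (Hdf0 : Re df = 0).
  { assert (K : 2 * h x0 * Re df = 0).
    { apply (derive_zero_at_max (fun t => h t ^ 2) (x0 - 1) (x0 + 1) x0); [lra| |intros; apply Hhmax].
      replace (2 * h x0 * Re df) with (INR 2 * Re df * h x0 ^ Nat.pred 2) by (simpl; ring).
      apply is_derive_pow. apply (real_derivative f), Hdf. }
    apply Rmult_integral in K. destruct K as [K|K]; [|exact K]. exfalso; apply Hh0; lra. }
  assert (HiQ := derivative_real Q x0 dQ hQreal HdQ). assert (Hif := derivative_real f x0 df Hfreal Hdf).
  set (G := fun z => (Q z * f z)%C).
  destruct (product_growth tau sigma Q f htau hsigma hQ Hf) as [HG HGg]. fold G in HG, HGg. fold s in HGg.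
  assert (HGreal : real_on_R G).
  { intros t. assert (K1 := hQreal t). assert (K2 := Hfreal t). unfold G. destruct (Q (RtoC t)), (f (RtoC t)). simpl in *. subst. ring. }
  assert (Hl := is_cderive_mult Q f _ _ _ HdQ Hdf). fold G in Hl.
  set (l := (dQ * f (RtoC x0) + Q (RtoC x0) * df)%C) in *.
  assert (HQ0 := hQreal x0). assert (Hf0 := Hfreal x0).
  assert (HRel : Re l = Re dQ * h x0).
  { unfold l, h. destruct dQ, df, (Q (RtoC x0)), (f (RtoC x0)). simpl in *. subst. ring. }
  assert (HIml : Im l = 0) by (apply (derivative_real G x0); assumption).
  assert (HReG : Re (G (RtoC x0)) = Re (Q (RtoC x0)) * h x0).
  { unfold G, h. destruct (Q (RtoC x0)), (f (RtoC x0)). simpl in *. subst. ring. }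
  assert (B := bernstein_szego G s M x0 l HG HGreal Hs HM0 HGg Hb Hl).
  assert (Hh2 : A_inf s Q * h x0 ^ 2 = s ^ 2 * M ^ 2).
  { rewrite <- Hmod, Heq. rewrite <- (sqrt_sqrt (A_inf s Q)) at 1 by lra. field. lra. }
  assert (Beq : Re l ^ 2 + s ^ 2 * Re (G (RtoC x0)) ^ 2 = s ^ 2 * M ^ 2).
  { apply Rle_antisym; [exact B|]. rewrite <- Hh2, HRel, HReG.
    replace ((Re dQ * h x0) ^ 2 + s ^ 2 * (Re (Q (RtoC x0)) * h x0) ^ 2)
      with ((Re dQ ^ 2 + s ^ 2 * Re (Q (RtoC x0)) ^ 2) * h x0 ^ 2) by ring.
    apply Rmult_le_compat_r; [apply pow2_ge_0|apply HAt]. }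
  destruct (bernstein_szego_equality G s M x0 l HG HGreal Hs HM0 HGg Hb Hl HIml Beq) as [theta Hth].
  { eapply Rle_lt_trans; [apply re_le_Cmod|exact Hlt]. }
  set (phi := theta - s * x0).
  exists (- M * sin phi), (M * cos phi). split.
  + rewrite !Rabs_mult, Rabs_Ropp, (Rabs_pos_eq M) by lra.
    assert (Hsc := sin2_cos2 phi). unfold Rsqr in Hsc.
    assert (P1 := Rabs_pos (sin phi)). assert (P2 := Rabs_pos (cos phi)).
    assert (0 < Rabs (sin phi) + Rabs (cos phi)).
    { destruct (Req_dec (sin phi) 0) as [Z|Z].
      - assert (cos phi <> 0) by (intros Z2; rewrite Z, Z2 in Hsc; lra).
        assert (0 < Rabs (cos phi)) by (apply Rabs_pos_lt; assumption). lra.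
      - assert (0 < Rabs (sin phi)) by (apply Rabs_pos_lt; assumption). lra. }
    nra.
  + intros x. specialize (Hth x). assert (HGx := HGreal x). fold (G (RtoC x)).
    apply injective_projections.
    * change (fst (G (RtoC x))) with (Re (G (RtoC x))). rewrite Hth.
      replace (s * (x - x0) + theta) with (s * x + phi) by (unfold phi; ring).
      rewrite cos_plus. simpl. ring.
    * exact HGx.
Qed.
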